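(* Let $X$ and $Y$ be Hausdorff compact spaces and let $\pi: X \to Y$ be a fully closed continuous map of $X$ onto $Y$. Suppose that $C(Y)$ admits an equivalent norm that is LUR and lower semicontinuous with respect to the pointwise topology $\tau_p$, and that for every $y \in Y$ the space $C\left(\pi^{-1}(y)\right)$ admits an equivalent norm that is LUR and $\tau_p$-lower semicontinuous. Then $C(X)$ admits an equivalent norm that is LUR and $\tau_p$-lower semicontinuous.
   Context: For a compact space $K$, $C(K)$ denotes the Banach space of real-valued continuous functions on $K$ with the supremum norm. A continuous surjection $\pi: X \to Y$ between Hausdorff compact spaces is called fully closed if for any two closed disjoint subsets $F_1, F_2 \subset X$ the set $\pi(F_1) \cap \pi(F_2)$ is finite. A norm $\|\cdot\|$ on a Banach space $E$ is locally uniformly rotund (LUR) if for every $x$ in the unit sphere $S_E$ and every sequence $(x_n) \subset S_E$, $\lim_n \|(x+x_n)/2\| = 1$ implies $\lim_n \|x - x_n\| = 0$. An equivalent norm is one equivalent to the original norm. A norm on $C(K)$ is $\tau_p$-lower semicontinuous if it is lower semicontinuous with respect to the topology of pointwise convergence on $K$. *)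

(* Defs.v *)
From HB Require Import structures.
From mathcomp Require Import all_boot all_order all_algebra.
From mathcomp Require Import all_classical all_reals all_analysis.
Set Implicit Arguments. Unset Strict Implicit. Unset Printing Implicit Defensive.
Import Order.TTheory GRing.Theory Num.Theory.
Import numFieldNormedType.Exports.
Local Open Scope classical_set_scope.
Local Open Scope ring_scope.

(* C(A), for A a subset of a topological space T (with the subspace
   topology), is represented by the functions f : T -> R that are
   continuous within A; two such functions are identified when they agree
   on A.  A "norm on C(A)" is a function N : (T -> R) -> R that only
   depends on the values on A and satisfies the norm axioms on C(A). *)

Definition CA {R : realType} {T : topologicalType} (A : set T) (f : T -> R) :=
  {within A, continuous f}.

Definition supnorm {R : realType} {T : topologicalType} (A : set T)
  (f : T -> R) : R := sup [set `|f x| | x in A].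

Definition is_norm_on_C {R : realType} {T : topologicalType} (A : set T)
  (N : (T -> R) -> R) : Prop :=
  [/\ (forall f g, {in A, f =1 g} -> N f = N g),
      (forall f, CA A f -> 0 <= N f),
      (forall f, CA A f -> N f = 0 -> forall x, A x -> f x = 0),
      (forall (a : R) f, CA A f -> N (fun x => a * f x) = `|a| * N f) &
      (forall f g, CA A f -> CA A g -> N (fun x => f x + g x) <= N f + N g)].

Definition equiv_to_sup {R : realType} {T : topologicalType} (A : set T)
  (N : (T -> R) -> R) : Prop :=
  exists a b : R, [/\ 0 < a, 0 < b &
    forall f, CA A f -> a * supnorm A f <= N f /\ N f <= b * supnorm A f].

Definition LUR {R : realType} {T : topologicalType} (A : set T)
  (N : (T -> R) -> R) : Prop :=
  forall (x : T -> R) (xs : nat -> T -> R),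
    CA A x -> (forall n, CA A (xs n)) ->
    N x = 1 -> (forall n, N (xs n) = 1) ->
    (fun n => N (fun t => (x t + xs n t) / 2)) @ \oo --> (1 : R) ->
    (fun n => N (fun t => x t - xs n t)) @ \oo --> (0 : R).

(* lower semicontinuity w.r.t. the topology of pointwise convergence on A
   (written out with the basic neighbourhoods of that topology) *)
Definition tau_p_lsc {R : realType} {T : topologicalType} (A : set T)
  (N : (T -> R) -> R) : Prop :=
  forall f, CA A f -> forall e : R, 0 < e ->
    exists (F : seq T) (d : R), [/\ (forall t, t \in F -> A t), 0 < d &
      forall g, CA A g -> (forall t, t \in F -> `|g t - f t| < d) ->
        N f - e < N g].

Definition has_LUR_lsc_norm (R : realType) {T : topologicalType} (A : set T)
  : Prop :=
  exists N : (T -> R) -> R,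
    [/\ is_norm_on_C A N, equiv_to_sup A N, LUR A N & tau_p_lsc A N].

Definition compact_hausdorff (T : topologicalType) : Prop :=
  hausdorff_space T /\ compact [set: T].

Definition fully_closed {X Y : topologicalType} (p : X -> Y) : Prop :=
  forall F1 F2 : set X, closed F1 -> closed F2 -> F1 `&` F2 = set0 ->
    finite_set (p @` F1 `&` p @` F2).

(* Main.v *)
(* For f in C(X) the oscillations of f on the fibres of p form a c_0-family,
   because p is fully closed, and the functions with zero oscillation on every
   fibre are those of C(Y). So C(X) is an extension of C(Y) whose quotient
   embeds into a c_0-sum of spaces attached to the fibres.
   - Quotient: Deville's lemma applied to sums of oscillations (to select the
     fibres) and of squared fibre norms (to get convergence on the selected
     ones) yields a convex pointwise lower semicontinuous G such that a small
     midpoint gap of G at f, g makes all fibre oscillations of f - g small.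
   - Three-space step: write f = U + (an element of C(Y)). A second use of
     Deville's lemma, with the functionals G f - 2 gap G f a indexed by a,
     selects an index a close to f modulo C(Y); then an approximation of U
     computed from a is subtracted from f and g, and the LUR norm of C(Y)
     is applied to what remains. The approximations of U need only be locally
     constant on countably many pieces, which a well order provides.
   The norm is the Minkowski gauge of the resulting convex function; avoiding
   homogeneity until that point makes every functional elementary. *)
Require Import Defs.
From HB Require Import structures.
From mathcomp Require Import all_boot all_order all_algebra.
From mathcomp Require Import all_classical all_reals all_analysis.
From mathcomp Require Import ring lra.
Set Implicit Arguments. Unset Strict Implicit. Unset Printing Implicit Defensive.
Import Order.TTheory GRing.Theory Num.Theory.
Import numFieldNormedType.Exports.
Local Open Scope classical_set_scope.
Local Open Scope ring_scope.

(** Only countably many functionals can be summed, and none may depend on the point [f] at which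
    rotundity is tested, whereas the relevant fibres and the class of [f] modulo C(Y) range over
    uncountable families. Suprema over whole families preserve convexity and pointwise lower
    semicontinuity, and Deville's lemma recovers from such a supremum a member suited to [f]. Full
    closedness enters only through the finiteness of the set of fibres on which [f] oscillates by
    more than a given amount: with m equal to their number, a near-optimal choice of m fibres must
    contain those of clearly larger oscillation. In the three-space step the same function has to be
    subtracted from [f] and [g], though the functional knows neither; it can be read off the
    selected index because the approximations are constant near [f] on a piece. Pointwise lower
    semicontinuity of the norm on C(Y) is what lets it extend to a seminorm on C(X) of the same
    kind. *)

Section supnorm.
Context {R : realType} {T : topologicalType}.
Implicit Types (A : set T) (f : T -> R).

Lemma le_supnorm A f x : compact A -> CA A f -> A x -> `|f x| <= supnorm A f.
Proof.
move=> cA cf Ax.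
have /compact_bounded [M [_ HM]] := continuous_compact cf cA.
apply: ub_le_sup; last by exists x.
exists (M + 1) => _ [y Ay <-].
by apply: (HM (M + 1)); [rewrite ltrDl | exists y].
Qed.

Lemma supnorm_le A f r : 0 <= r -> (forall x, A x -> `|f x| <= r) ->
  supnorm A f <= r.
Proof.
move=> r0 h; rewrite /supnorm.
have [->|/set0P ne] := eqVneq [set `|f x| | x in A] set0; first by rewrite sup0.
by apply: ge_sup => // _ [x Ax <-]; exact: h.
Qed.

Lemma supnorm_ge0 A f : compact A -> CA A f -> 0 <= supnorm A f.
Proof.
move=> cA cf; have [->|/set0P[x Ax]] := eqVneq A set0.
  by rewrite /supnorm image_set0 sup0.
exact: le_trans (le_supnorm cA cf Ax).
Qed.

Lemma CA_continuous f : CA setT f <-> continuous f.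
Proof.
split; last exact: continuous_subspaceT.
by move=> cf; apply/continuous_subspace_setT.
Qed.

Lemma continuous_lin f g (a b : R) : continuous f -> continuous g ->
  continuous (fun x => a * f x + b * g x).
Proof. by move=> cf cg x; apply: cvgD; apply: cvgM (cvg_cst _) _; [exact: cf|exact: cg]. Qed.

Lemma CA_lin A f g (a b : R) : CA A f -> CA A g ->
  CA A (fun x => a * f x + b * g x).
Proof. by move=> cf cg x; apply: cvgD; apply: cvgM (cvg_cst _) _; [exact: cf|exact: cg]. Qed.

End supnorm.

Section continuity.
Context {R : realType} {X : topologicalType}.
Implicit Types (f g : X -> R).

Definition mid f g : X -> R := fun x => (f x + g x) / 2.

Lemma continuous_scale f (a : R) : continuous f -> continuous (fun x => a * f x).
Proof. by move=> cf x; apply: cvgM (cvg_cst _) _; exact: cf. Qed.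

Lemma continuous_add f g : continuous f -> continuous g ->
  continuous (fun x => f x + g x).
Proof. by move=> cf cg x; apply: cvgD; [exact: cf|exact: cg]. Qed.

Lemma continuous_sub f g : continuous f -> continuous g ->
  continuous (fun x => f x - g x).
Proof. by move=> cf cg x; apply: cvgB; [exact: cf|exact: cg]. Qed.

Lemma continuous_mid f g : continuous f -> continuous g -> continuous (mid f g).
Proof.
move=> cf cg; rewrite (_ : mid f g = fun x => 2^-1 * f x + 2^-1 * g x).
  exact: continuous_lin.
by apply/funext => x; rewrite /mid; field.
Qed.

Lemma continuous_const (c : R) : continuous (fun _ : X => c).
Proof. by move=> x; exact: cvg_cst. Qed.

End continuity.

#[local] Hint Resolve continuous_lin continuous_scale continuous_add
  continuous_sub continuous_mid continuous_const : core.

(** * Convexity, pointwise lower semicontinuity and midpoint gaps *)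

Section functionals.
Context {R : realType} {X : topologicalType}.
Implicit Types (f g : X -> R) (G S : (X -> R) -> R).

(* All renorming arguments are phrased by small gaps: for [G] the square of a
   norm, [LUR] says that [gap G f g] small forces [g] close to [f]. *)
Definition gap G f g : R := G f / 2 + G g / 2 - G (mid f g).
Definition nrm f : R := supnorm [set: X] f.

Definition convexf G := forall f g (t : R), continuous f -> continuous g ->
  0 <= t -> t <= 1 ->
  G (fun x => t * f x + (1 - t) * g x) <= t * G f + (1 - t) * G g.

Definition plsc G := forall f, continuous f -> forall e : R, 0 < e ->
  exists (F : seq X) (d : R), 0 < d /\
    forall g, continuous g -> (forall t, t \in F -> `|g t - f t| < d) ->
      G f - e < G g.

(** Quadratic growth accommodates squares of seminorms, is stable under affine substitutions, and
    gives the bounds that keep suprema and weighted countable sums finite. *)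
Record good (C : R) G : Prop := Good {
  good_cvx : convexf G;
  good_lsc : plsc G;
  good_bnd : forall f, continuous f -> `|G f| <= C * (1 + nrm f) ^+ 2 }.

Record lsc_seminorm (C : R) S : Prop := LscSeminorm {
  sn_ge0 : forall f, continuous f -> 0 <= S f;
  sn_hom : forall (a : R) f, continuous f -> S (fun x => a * f x) = `|a| * S f;
  sn_tri : forall f g, continuous f -> continuous g ->
    S (fun x => f x + g x) <= S f + S g;
  sn_bnd : forall f, continuous f -> S f <= C * nrm f;
  sn_lsc : plsc S }.

Lemma gap_ge0 G f g : convexf G -> continuous f -> continuous g ->
  0 <= gap G f g.
Proof.
move=> cG cf cg; have := cG f g 2^-1 cf cg.
rewrite (_ : (fun _ => _) = mid f g); last first.
  by apply/funext => x; rewrite /mid; field.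
by rewrite /gap => /(_ ltac:(lra) ltac:(lra)); lra.
Qed.

Lemma plsc_add G H : plsc G -> plsc H -> plsc (fun f => G f + H f).
Proof.
move=> lG lH f cf e e0.
have [F1 [d1 [d10 h1]]] := lG f cf (e / 2) ltac:(lra).
have [F2 [d2 [d20 h2]]] := lH f cf (e / 2) ltac:(lra).
exists (F1 ++ F2), (Num.min d1 d2); split; first by rewrite lt_min d10.
move=> g cg hg.
have a1 : G f - e / 2 < G g.
  apply: h1 => // t tF.
  by have := hg t; rewrite mem_cat tF lt_min => /(_ isT)/andP[].
have a2 : H f - e / 2 < H g.
  apply: h2 => // t tF.
  by have := hg t; rewrite mem_cat tF orbT lt_min => /(_ isT)/andP[].
lra.
Qed.

Lemma plsc_scale G (a : R) : 0 <= a -> plsc G -> plsc (fun f => a * G f).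
Proof.
move=> a0 lG f cf e e0.
have e1 : 0 < e / (a + 1) by apply: divr_gt0 => //; lra.
have [F [d [d0 h]]] := lG f cf _ e1.
exists F, d; split => // g cg hg; have := h g cg hg.
have : a * (e / (a + 1)) < e.
  have eq : e / (a + 1) * (a + 1) = e by rewrite divfK //; apply: lt0r_neq0; lra.
  by nra.
by move=> h1 h2; have := ler_wpM2l a0 (ltW h2); rewrite mulrBr; lra.
Qed.

Lemma plsc_comp G (a : R) b : continuous b -> plsc G ->
  plsc (fun f => G (fun x => a * f x + b x)).
Proof.
move=> cb lG f cf e e0.
have cont h : continuous h -> continuous (fun x => a * h x + b x) by auto.
have [F [d [d0 h]]] := lG _ (cont _ cf) e e0.
have a1 : 0 < `|a| + 1 by rewrite ltr_wpDl.
exists F, (d / (`|a| + 1)); split; first exact: divr_gt0.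
move=> g cg hg; apply: h; first exact: cont.
move=> t /hg; have -> : a * g t + b t - (a * f t + b t) = a * (g t - f t) by ring.
by rewrite ltr_pdivlMr // normrM; have := normr_ge0 (g t - f t); nra.
Qed.

Lemma plsc_sup (I : Type) (G : I -> (X -> R) -> R) :
  (forall i, plsc (G i)) ->
  (forall f, continuous f -> has_sup (range (fun i => G i f))) ->
  plsc (fun f => sup (range (fun i => G i f))).
Proof.
move=> lG hs f cf e e0.
have [_ [i _ <-] hi] := sup_adherent (divr_gt0 e0 (ltr0n R 2)) (hs f cf).
have [F [d [d0 h]]] := lG i f cf (e / 2) ltac:(lra).
exists F, d; split => // g cg hg; have := h g cg hg.
have : G i g <= sup (range (fun i => G i g)).
  by apply: (sup_upper_bound (hs g cg)); exists i.
lra.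
Qed.

End functionals.

(** * Convex functionals and seminorms on C(X) *)

Section good_functionals.
Context {R : realType} {X : topologicalType}.
Hypothesis cX : compact [set: X].
Implicit Types (f g : X -> R) (G S : (X -> R) -> R) (C : R).

Lemma le_nrm f x : continuous f -> `|f x| <= nrm f.
Proof. by move=> /CA_continuous cf; exact: le_supnorm. Qed.

Lemma nrm_ge0 f : continuous f -> 0 <= nrm f.
Proof. by move=> /CA_continuous cf; exact: supnorm_ge0. Qed.

Lemma nrm_le f r : 0 <= r -> (forall x, `|f x| <= r) -> nrm f <= r.
Proof. by move=> r0 h; apply: supnorm_le. Qed.

Hint Resolve nrm_ge0 : core.

Lemma good_add C D G H : good C G -> good D H ->
  good (C + D) (fun f => G f + H f).
Proof.
move=> [cG lG bG] [cH lH bH]; split; last 1 first.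
- move=> f cf; rewrite mulrDl; apply: le_trans (ler_normD _ _) _.
  exact: lerD (bG _ cf) (bH _ cf).
- move=> f g t cf cg t0 t1.
  by have := cG f g t cf cg t0 t1; have := cH f g t cf cg t0 t1; lra.
- exact: plsc_add.
Qed.

Lemma good_scale C G (a : R) : 0 <= a -> good C G ->
  good (a * C) (fun f => a * G f).
Proof.
move=> a0 [cG lG bG]; split; last 1 first.
- move=> f cf; rewrite normrM (ger0_norm a0) -mulrA.
  exact: ler_wpM2l (bG _ cf).
- move=> f g t cf cg t0 t1.
  by have := ler_wpM2l a0 (cG f g t cf cg t0 t1); nra.
- exact: plsc_scale.
Qed.

Lemma good_weaken C D G : C <= D -> good C G -> good D G.
Proof.
move=> CD [cG lG bG]; split => // f cf; apply: le_trans (bG f cf) _.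
by apply: ler_wpM2r => //; exact: sqr_ge0.
Qed.

Lemma good_cst (c : R) : good `|c| (fun _ : X -> R => c).
Proof.
split=> [f g t _ _ _ _|f cf e e0|f cf]; first by lra.
- by exists [::], 1; split => // g _ _; lra.
- by rewrite ler_peMr //; have := nrm_ge0 cf; nra.
Qed.

(** The growth stays quadratic because 1 + |f| + |b| <= (1 + |f|) (1 + |b|); the condition on [a]
    avoids a further factor. *)
Lemma good_comp C G (a : R) b : continuous b -> `|a| <= 1 -> good C G ->
  good (C * (1 + nrm b) ^+ 2) (fun f => G (fun x => a * f x + b x)).
Proof.
move=> cb a1 [cG lG bG].
have cont h : continuous h -> continuous (fun x => a * h x + b x).
  by move=> ch; apply: continuous_add => //; exact: continuous_scale.
split; last 1 first.
- move=> f cf; apply: le_trans (bG _ (cont _ cf)) _.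
  have C0 : 0 <= C.
    have := le_trans (normr_ge0 _) (bG _ cb).
    by rewrite pmulr_lge0 // exprn_gt0 // ltr_pwDl // nrm_ge0.
  rewrite -mulrA -exprMn; apply: ler_wpM2l => //.
  have f0 := nrm_ge0 cf; have b0 := nrm_ge0 cb.
  have w0 := nrm_ge0 (cont _ cf).
  rewrite ler_sqr ?nnegrE; [|nra|nra].
  suff : nrm (fun x => a * f x + b x) <= nrm f + nrm b by nra.
  apply: nrm_le; first by lra.
  move=> x; apply: le_trans (ler_normD _ _) _.
  have := le_nrm x cf; have := le_nrm x cb; rewrite normrM.
  by have := normr_ge0 (f x); nra.
- move=> f g t cf cg t0 t1.
  apply: le_trans (cG _ _ t (cont _ cf) (cont _ cg) t0 t1).
  by rewrite le_eqVlt; apply/orP; left; apply/eqP; congr G; apply/funext => x; ring.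
- exact: plsc_comp.
Qed.

Lemma convexf_sup (I : Type) (G : I -> (X -> R) -> R) :
  (forall i, convexf (G i)) ->
  (forall f, continuous f -> has_sup (range (fun i => G i f))) ->
  convexf (fun f => sup (range (fun i => G i f))).
Proof.
move=> cG hs f g t cf cg t0 t1.
have cfg : continuous (fun x => t * f x + (1 - t) * g x) by exact: continuous_lin.
apply: ge_sup; first by have [] := hs _ cfg.
move=> _ [i _ <-]; apply: le_trans (cG i _ _ t cf cg t0 t1) _.
apply: lerD; apply: ler_wpM2l; rewrite ?subr_ge0 //.
- by apply: (sup_upper_bound (hs f cf)); exists i.
- by apply: (sup_upper_bound (hs g cg)); exists i.
Qed.

(** The supremum inherits its lower bound from the single member [i0], so the family need not be
    uniformly bounded below. [piece_functional] relies on this. *)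
Lemma good_sup (I : Type) (i0 : I) C (G : I -> (X -> R) -> R) :
  (forall i, convexf (G i)) -> (forall i, plsc (G i)) ->
  (forall i f, continuous f -> G i f <= C * (1 + nrm f) ^+ 2) ->
  (forall f, continuous f -> - (C * (1 + nrm f) ^+ 2) <= G i0 f) ->
  (forall f, continuous f -> has_sup (range (fun i => G i f))) /\
  good C (fun f => sup (range (fun i => G i f))).
Proof.
move=> cG lG uG bG.
have hs f : continuous f -> has_sup (range (fun i => G i f)).
  move=> cf; split; first by exists (G i0 f), i0.
  by exists (C * (1 + nrm f) ^+ 2) => _ [i _ <-]; exact: uG.
split => //; split.
- exact: convexf_sup.
- exact: plsc_sup.
- move=> f cf; rewrite ler_norml; apply/andP; split.
    apply: le_trans (bG f cf) _.
    by apply: (sup_upper_bound (hs f cf)); exists i0.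
  by apply: ge_sup; [have [] := hs _ cf|move=> _ [i _ <-]; exact: uG].
Qed.

Lemma sn_convex C S : lsc_seminorm C S -> convexf S.
Proof.
move=> [_ h t _ _] f g a cf cg a0 a1; apply: le_trans (t _ _ _ _) _ => //.
- exact: continuous_scale.
- exact: continuous_scale.
- by rewrite !h // !ger0_norm //; lra.
Qed.

Lemma sn_good C S : 0 <= C -> lsc_seminorm C S -> good C S.
Proof.
move=> C0 sS; split; [exact: sn_convex sS|exact: sn_lsc sS|].
move=> f cf; rewrite ger0_norm; last exact: (sn_ge0 sS).
apply: le_trans (sn_bnd sS cf) _; apply: ler_wpM2l => //.
by have := nrm_ge0 cf; nra.
Qed.

Lemma sn_sqr C S : 0 <= C -> lsc_seminorm C S -> good (C ^+ 2) (fun f => S f ^+ 2).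
Proof.
move=> C0 sS; have S0 := sn_ge0 sS; split.
- move=> f g t cf cg t0 t1.
  have := sn_convex sS cf cg t0 t1.
  have := S0 _ (@continuous_lin _ _ _ _ t (1 - t) cf cg).
  move: (S0 _ cf) (S0 _ cg); set u := S _; set v := S _; set w := S _.
  move=> u0 v0 w0 h.
  have : w ^+ 2 <= (t * u + (1 - t) * v) ^+ 2 by nra.
  move=> h1; apply: le_trans h1 _; rewrite -subr_ge0.
  rewrite (_ : _ - _ = t * (1 - t) * (u - v) ^+ 2); last by ring.
  by rewrite mulr_ge0 ?sqr_ge0 // mulr_ge0 // subr_ge0.
- move=> f cf e e0.
  have a0 := S0 _ cf; set a := S f in a0 *.
  (* If a - q < b < a, then a^2 - b^2 < 2 a q < e; the added 1 covers a = 0. *)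
  have q0 : 0 < e / (2 * a + 1) by apply: divr_gt0 => //; lra.
  have eq : e / (2 * a + 1) * (2 * a + 1) = e.
    by rewrite divfK //; apply: lt0r_neq0; lra.
  have [F [d [d0 h]]] := sn_lsc sS cf q0.
  exists F, d; split => // g cg hg; have := h g cg hg; have := S0 _ cg.
  rewrite -/a; move: q0 eq; set q := e / _; set b := S g => q0 eq b0 ab.
  have [?|?] := leP a b; first by nra.
  nra.
- move=> f cf; rewrite ger0_norm ?sqr_ge0 //; have := sn_bnd sS cf.
  have := S0 _ cf; have := nrm_ge0 cf; rewrite -exprMn => n0 s0 sb.
  rewrite ler_sqr ?nnegrE; nra.
Qed.

(** For numbers, (u^2 + v^2) / 2 - ((u + v) / 2)^2 equals ((u - v) / 2)^2, and [S] at the midpoint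
    is at most the mean. So a small gap of the square forces [S g] close to [S f]. *)
Lemma gap_sqr C S f g : lsc_seminorm C S -> continuous f -> continuous g ->
  ((S f - S g) / 2) ^+ 2 <= gap (fun f => S f ^+ 2) f g.
Proof.
move=> sS cf cg; rewrite /gap.
have := sn_ge0 sS (continuous_mid cf cg).
have : S (mid f g) <= (S f + S g) / 2.
  rewrite (_ : mid f g = fun x => 2^-1 * (f x + g x)); last first.
    by apply/funext => x; rewrite /mid mulrC.
  rewrite (sn_hom sS); last exact: continuous_add.
  by rewrite ger0_norm; have := sn_tri sS cf cg; lra.
by nra.
Qed.

Lemma sn_sup (I : Type) (i0 : I) C (S : I -> (X -> R) -> R) :
  (forall i, lsc_seminorm C (S i)) ->
  (forall f, continuous f -> has_sup (range (fun i => S i f))) /\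
  lsc_seminorm C (fun f => sup (range (fun i => S i f))).
Proof.
move=> sS.
have hs f : continuous f -> has_sup (range (fun i => S i f)).
  move=> cf; split; first by exists (S i0 f), i0.
  by exists (C * nrm f) => _ [i _ <-]; exact: (sn_bnd (sS i)).
split => //.
have ub i f : continuous f -> S i f <= sup (range (fun i => S i f)).
  by move=> cf; apply: (sup_upper_bound (hs f cf)); exists i.
have lub f r : continuous f -> (forall i, S i f <= r) ->
    sup (range (fun i => S i f)) <= r.
  by move=> cf h; apply: ge_sup; [have [] := hs _ cf|move=> _ [i _ <-]].
have hom0 (a : R) f : continuous f ->
    sup (range (fun i => S i (fun x => a * f x))) <=
      `|a| * sup (range (fun i => S i f)).
  move=> cf; apply: lub => [|i]; first exact: continuous_scale.
  by rewrite (sn_hom (sS i)) // ler_wpM2l // ub.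
split.
- by move=> f cf; apply: le_trans (ub i0 f cf); exact: (sn_ge0 (sS i0)).
- move=> a f cf; apply/eqP; rewrite eq_le hom0 //=.
  have [->|a0] := eqVneq a 0.
    rewrite normr0 mul0r; apply: le_trans (ub i0 _ _); last exact: continuous_scale.
    by apply: (sn_ge0 (sS i0)); exact: continuous_scale.
  rewrite mulrC -ler_pdivlMr ?normr_gt0 //.
  have := hom0 a^-1 _ (continuous_scale (a := a) cf).
  rewrite (_ : (fun x => _) = f); last by apply/funext => x; rewrite mulKf.
  by rewrite normfV mulrC.
- move=> f g cf cg; apply: lub => [|i]; first exact: continuous_add.
  by apply: le_trans (sn_tri (sS i) cf cg) _; apply: lerD; exact: ub.
- by move=> f cf; apply: lub => // i; exact: (sn_bnd (sS i)).
- by apply: plsc_sup => // i; exact: (sn_lsc (sS i)).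
Qed.

Lemma sn_zero : lsc_seminorm 0 (fun _ : X -> R => 0 : R).
Proof.
split=> //= *; rewrite ?mulr0 ?mul0r ?addr0 //.
by move=> f cf e e0; exists [::], 1; split => // g _ _; lra.
Qed.

Lemma sn_add C D S T : lsc_seminorm C S -> lsc_seminorm D T -> lsc_seminorm (C + D) (fun f => S f + T f).
Proof.
move=> [S0 Sh St Sb Sl] [T0 Th Tt Tb Tl]; split.
- by move=> f cf; rewrite addr_ge0 ?S0 ?T0.
- by move=> a f cf; rewrite Sh // Th // mulrDr.
- by move=> f g cf cg; have := St f g cf cg; have := Tt f g cf cg; lra.
- by move=> f cf; rewrite mulrDl lerD ?Sb ?Tb.
- exact: plsc_add.
Qed.

Lemma sn_diff (s t : X) : lsc_seminorm 2 (fun f : X -> R => `|f s - f t|).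
Proof.
split=> //.
- by move=> a f cf; rewrite -mulrBr normrM.
- move=> f g cf cg; rewrite (_ : _ - _ = (f s - f t) + (g s - g t)); last by ring.
  exact: ler_normD.
- move=> f cf; apply: le_trans (ler_normB _ _) _.
  by have := le_nrm s cf; have := le_nrm t cf; lra.
- move=> f cf e e0; exists [:: s; t], (e / 2); split; first by lra.
  move=> g cg h; have := h s; have := h t; rewrite !inE !eqxx orbT.
  move=> /(_ isT) h1 /(_ isT) h2.
  have : `|f s - f t| <= `|g s - f s| + `|g s - g t| + `|g t - f t|.
    rewrite (_ : f s - f t = - (g s - f s) + (g s - g t) + (g t - f t)); last by ring.
    apply: le_trans (ler_normD _ _) _; rewrite lerD2r.
    by apply: le_trans (ler_normD _ _) _; rewrite normrN.
  lra.
Qed.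

Lemma sn_eval (t : X) : lsc_seminorm 1 (fun f : X -> R => `|f t|).
Proof.
split=> //.
- by move=> a f cf; rewrite normrM.
- by move=> f g cf cg; exact: ler_normD.
- by move=> f cf; rewrite mul1r le_nrm.
- move=> f cf e e0; exists [:: t], e; split => //.
  move=> g cg h; have := h t; rewrite !inE !eqxx => /(_ isT) h1.
  have := ler_normD (g t) (f t - g t); rewrite addrC subrK distrC; lra.
Qed.

Lemma sn_nrm : X -> lsc_seminorm 1 (nrm : (X -> R) -> R).
Proof.
move=> x0; have [_] := sn_sup x0 sn_eval.
by rewrite (_ : (fun f => _) = nrm).
Qed.

End good_functionals.

(** * Countable sums and Deville's lemma *)

Section sums_of_functionals.
Context {R : realType} {X : topologicalType}.
Hypothesis cX : compact [set: X].
Implicit Types (f g : X -> R) (G S : (X -> R) -> R) (C : R).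

(** Makes a convex functional even, nonnegative and zero at 0, as the gauge requires, without
    decreasing any gap. The reflection is written in the shape of [good_comp]. *)
Definition symm G f := G f + G (fun x => - 1 * f x + 0) - 2 * G (fun=> 0).

Lemma good_symm C G : good C G -> exists D, 0 < D /\ good D (symm G).
Proof.
move=> gG; have c0 : continuous (fun _ : X => 0 : R) by [].
have n1 : `|-1 : R| <= 1 by rewrite normrN1.
have h := good_add (good_add gG (good_comp cX c0 n1 gG))
  (good_cst cX (- (2 * G (fun=> 0)))).
set D := (X in good X _) in h.
by exists (`|D| + 1); split; [rewrite ltr_wpDl | apply: good_weaken h => //; have := ler_norm D; lra].
Qed.

Lemma symm_ge0 G f : convexf G -> continuous f -> 0 <= symm G f.
Proof.
move=> cG cf; have cf' : continuous (fun x => - 1 * f x + 0).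
  by apply: continuous_add => //; exact: continuous_scale.
have := gap_ge0 cG cf cf'; rewrite /gap /symm.
rewrite (_ : mid f _ = fun=> 0); first by lra.
by apply/funext => x; rewrite /mid; field.
Qed.

Lemma symm_opp G f : symm G (fun x => - f x) = symm G f.
Proof.
rewrite /symm (_ : (fun x => -1 * - f x + 0) = f); last by apply/funext => x; ring.
rewrite (_ : (fun x => - f x) = (fun x => -1 * f x + 0)); first by ring.
by apply/funext => x; ring.
Qed.

Lemma symm_0 G : symm G (fun=> 0) = 0.
Proof.
rewrite /symm (_ : (fun=> -1 * 0 + 0) = fun=> 0); first by ring.
by apply/funext => x; ring.
Qed.

Lemma gap_symm G f g : convexf G -> continuous f -> continuous g ->
  gap G f g <= gap (symm G) f g.
Proof.
move=> cG cf cg.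
have c' (h : X -> R) : continuous h -> continuous (fun x => - 1 * h x + 0).
  by move=> ch; apply: continuous_add => //; exact: continuous_scale.
have := gap_ge0 cG (c' _ cf) (c' _ cg); rewrite /gap /symm.
rewrite (_ : mid _ _ = fun x => -1 * mid f g x + 0); first by lra.
by apply/funext => x; rewrite /mid; field.
Qed.

(** After symmetrisation all terms are nonnegative, so the series is the supremum of its partial
    sums and [good_sup] applies. *)
Lemma good_sum (H : nat -> (X -> R) -> R) : (forall k, exists C, good C (H k)) ->
  exists G, [/\ good 1 G, (forall f, continuous f -> 0 <= G f),
    (forall f, G (fun x => - f x) = G f), G (fun=> 0) = 0 &
    forall k, exists c, 0 < c /\ forall f g, continuous f -> continuous g ->
      c * gap (H k) f g <= gap G f g].
Proof.
move=> gH.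
have /choice[D hD] : forall k, exists D, 0 < D /\ good D (symm (H k)).
  by move=> k; have [C /good_symm] := gH k.
(* Dividing by [D k] gives the k-th term growth constant 2^-(k+1), so that the n-th partial sum has
   constant 1 - 2^-n. *)
pose c k := 2^-1 ^+ k.+1 / D k.
have c0 k : 0 < c k by rewrite divr_gt0 ?exprn_gt0 ?(hD k).1 // invr_gt0.
pose S n f := \sum_(k < n) c k * symm (H k) f.
have S0 f : S 0%N f = 0 by rewrite /S big_ord0.
have SS n f : S n.+1 f = S n f + c n * symm (H n) f by rewrite /S big_ord_recr.
have gS n : good (1 - 2^-1 ^+ n) (S n).
  elim: n => [|n IH].
    rewrite expr0 subrr (_ : S 0%N = fun=> 0); last exact/funext.
    by rewrite -[X in good X](@normr0 _ R); exact: good_cst.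
  have := good_add IH (good_scale (ltW (c0 n)) (hD n).2).
  rewrite (_ : (fun f => _) = S n.+1); last by apply/funext => f; rewrite SS.
  apply: good_weaken; rewrite /c divfK; last by rewrite lt0r_neq0 ?(hD n).1.
  by rewrite exprS; lra.
have cH k : convexf (H k) by have [C []] := gH k.
have T0 k f : continuous f -> 0 <= c k * symm (H k) f.
  by move=> cf; rewrite mulr_ge0 ?symm_ge0 // ltW.
have Smono f m n : continuous f -> (m <= n)%N -> S m f <= S n f.
  move=> cf /subnK <-; elim: (n - m)%N => // d IH; rewrite addSn SS.
  by have := T0 (d + m)%N f cf; lra.
have Sb n f : continuous f -> `|S n f| <= (1 + nrm f) ^+ 2.
  move=> cf; apply: le_trans (good_bnd (gS n) cf) _.
  by rewrite ler_piMl ?sqr_ge0 // gerBl exprn_ge0 // invr_ge0.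
have [hs gG] : (forall f, continuous f -> has_sup (range (fun i => S i f))) /\
    good 1 (fun f => sup (range (fun i => S i f))).
  apply: (@good_sup R X nat 0%N 1 S).
  - by move=> n; exact: good_cvx (gS n).
  - by move=> n; exact: good_lsc (gS n).
  - by move=> n f cf; rewrite mul1r; apply: le_trans (ler_norm _) (Sb n f cf).
  - by move=> f cf; rewrite S0 mul1r oppr_le0 sqr_ge0.
have ub n f : continuous f -> S n f <= sup (range (fun i => S i f)).
  by move=> cf; apply: (sup_upper_bound (hs f cf)); exists n.
exists (fun f => sup (range (fun i => S i f))); split => //.
- by move=> f cf; apply: le_trans (ub 0%N _ cf); rewrite S0.
- move=> f; rewrite (_ : (fun i => S i (fun x => - f x)) = (fun i => S i f)) //.
  by apply/funext => n; apply: eq_bigr => k _; rewrite symm_opp.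
- rewrite /= (_ : range (fun i => S i (fun=> 0)) = [set 0]) ?sup1 //; apply/seteqP; split => [_ [n _ <-]|_ ->].
    by rewrite /S big1 // => k _; rewrite symm_0 mulr0.
  by exists 0%N; rewrite ?S0.
move=> k; exists (c k); split => // f g cf cg.
have cm := continuous_mid cf cg.
have gS0 n : (k < n)%N -> c k * gap (H k) f g <= gap (S n) f g.
  move=> kn; rewrite /gap /S !mulr_suml -big_split -sumrB (bigD1 (Ordinal kn)) //=.
  apply: le_trans (_ : c k * gap (symm (H k)) f g <= _).
    by rewrite ler_wpM2l ?gap_symm // ltW.
  rewrite -[X in X <= _]addr0; apply: lerD; first by rewrite /gap; lra.
  apply: sumr_ge0 => j _.
  have gj : convexf (symm (H j)) by exact: good_cvx (hD j).2.
  have := mulr_ge0 (ltW (c0 j)) (gap_ge0 gj cf cg).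
  by rewrite /gap; lra.
(* Otherwise take a partial sum within the defect of the supremum at the midpoint; at [f] and [g]
   partial sums lie below the supremum, which contradicts [gS0]. *)
rewrite leNgt; apply/negP => lt.
have [_ [n _ <-] hn] := sup_adherent (etrans (subr_gt0 _ _) lt) (hs _ cm).
have := gS0 (maxn n k.+1) (leq_maxr _ _); have := ub (maxn n k.+1) f cf.
have := ub (maxn n k.+1) g cg; have := Smono _ _ _ cm (leq_maxl n k.+1).
move: hn; rewrite /gap; lra.
Qed.

Lemma good_sum_countable (I : countType) (H : I -> (X -> R) -> R) :
  (forall i, exists C, good C (H i)) ->
  exists G, [/\ good 1 G, (forall f, continuous f -> 0 <= G f),
    (forall f, G (fun x => - f x) = G f), G (fun=> 0) = 0 &
    forall i, exists c, 0 < c /\ forall f g, continuous f -> continuous g ->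
      c * gap (H i) f g <= gap G f g].
Proof.
move=> gH.
have [|G [gG G0 Gs G00 Gc]] :=
    @good_sum (fun n => if unpickle n is Some i then H i else fun _ => 0).
  by move=> k; case: unpickle => // *; exists `|0 : R|; exact: good_cst.
by exists G; split => // i; have := Gc (pickle i); rewrite pickleK.
Qed.

(* Deville's lemma: a near-maximiser of [phi i + psi i / (k + 1)] at the
   midpoint nearly maximises [phi i] at [f], for [k] large, and has a small
   [psi]-gap. *)
Lemma good_master (I : Type) (i0 : I) C (phi psi : I -> (X -> R) -> R) :
  0 < C -> (forall i, convexf (phi i)) -> (forall i, plsc (phi i)) ->
  (forall i f, continuous f -> phi i f <= C * (1 + nrm f) ^+ 2) ->
  (forall f, continuous f -> - (C * (1 + nrm f) ^+ 2) <= phi i0 f) ->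
  (forall i, good C (psi i)) ->
  exists2 G, good 1 G & forall f (c e : R), continuous f -> 0 < c -> 0 < e ->
    exists2 d : R, 0 < d & forall g, continuous g -> gap G f g < d ->
      exists2 i, (forall j, phi j f <= phi i f + c) & gap (psi i) f g < e.
Proof.
move=> C0 cphi lphi uphi lbphi gpsi.
pose r k : R := (k.+1%:R)^-1.
have r0 k : 0 < r k by rewrite invr_gt0.
have r1 k : r k <= 1 by rewrite invf_le1 // ler1n.
pose th k i f := phi i f + r k * psi i f.
have psib i f : continuous f -> `|psi i f| <= C * (1 + nrm f) ^+ 2.
  exact: good_bnd (gpsi i) _.
have Cb f : continuous f -> 0 <= C * (1 + nrm f) ^+ 2.
  by move=> cf; apply: mulr_ge0 (ltW C0) (sqr_ge0 _).
have rpsi k i f : continuous f -> `|r k * psi i f| <= C * (1 + nrm f) ^+ 2.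
  move=> cf; rewrite normrM (gtr0_norm (r0 k)).
  have := psib i f cf; have := r1 k; have := r0 k; have := normr_ge0 (psi i f).
  by nra.
have gth k : (forall f, continuous f -> has_sup (range (fun i => th k i f))) /\
    good (2 * C) (fun f => sup (range (fun i => th k i f))).
  have gr i := good_scale (ltW (r0 k)) (gpsi i).
  apply: (@good_sup R X I i0 (2 * C) (th k)).
  - move=> i f g t cf cg t0 t1; have := cphi i f g t cf cg t0 t1.
    by have := good_cvx (gr i) cf cg t0 t1; rewrite /th; lra.
  - by move=> i; apply: plsc_add => //; exact: good_lsc (gr i).
  - move=> i f cf; have := uphi i f cf; have := rpsi k i f cf.
    by have := ler_norm (r k * psi i f); rewrite /th; lra.
  - move=> f cf; have := lbphi f cf; have := rpsi k i0 f cf.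
    by rewrite ler_norml /th => /andP[]; lra.
pose Th k f := sup (range (fun i => th k i f)).
have [|G [gG _ _ _ Gc]] := @good_sum Th.
  by move=> k; exists (2 * C); exact: (gth k).2.
exists G => // f c e cf c0 e0.
(* [K] bounds every difference [psi i f - psi j f], so for the chosen [k] the perturbation shifts
   the comparison of the [phi i f] by at most c / 2. *)
pose K := 2 * (C * (1 + nrm f) ^+ 2).
have [k hk] : exists k, r k * K <= c / 2.
  have K0 : 0 <= K by rewrite mulr_ge0 ?Cb.
  exists (Num.truncn (2 * K / c)).
  have := truncnS_gt (2 * K / c); rewrite ltr_pdivrMr // => h.
  by rewrite /r mulrC ler_pdivrMr; nra.
have [a [a0 ha]] := Gc k.
(* The index found below loses at most 4 d <= c / 2 at [f], and its [th]-gap is below 2 d <=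
   [r k * e], which bounds the [psi]-gap after division by [r k]. *)
pose d := Num.min (c / 8) (r k * e / 2).
have d0 : 0 < d by rewrite lt_min !divr_gt0 ?mulr_gt0.
have dc : d <= c / 8 by rewrite ge_min lexx.
have de : d <= r k * e / 2 by rewrite ge_min lexx orbT.
exists (a * d); first exact: mulr_gt0.
move=> g cg hg.
have cm := continuous_mid cf cg.
have hTh : gap (Th k) f g < d.
  by rewrite -(ltr_pM2l a0); apply: le_lt_trans (ha f g cf cg) hg.
have [hs _] := gth k.
have [_ [i _ <-] hi] := sup_adherent d0 (hs _ cm).
have ub j h : continuous h -> th k j h <= Th k h.
  by move=> ch; apply: (sup_upper_bound (hs h ch)); exists j.
have hi' : Th k (mid f g) - d < th k i (mid f g) by exact: hi.
have uf := ub i f cf; have ug := ub i g cg.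
have gphi := gap_ge0 (cphi i) cf cg.
have gpsi0 := gap_ge0 (good_cvx (gpsi i)) cf cg.
have gthE : gap (th k i) f g = gap (phi i) f g + r k * gap (psi i) f g.
  by rewrite /gap /th; ring.
have gth0 : 0 <= gap (th k i) f g.
  by rewrite gthE addr_ge0 // mulr_ge0 // ltW.
exists i.
  move=> j; have uj := ub j f cf.
  have : th k j f <= th k i f + 4 * d.
    by move: hTh gth0; rewrite /gap; lra.
  have : r k * (psi i f - psi j f) <= r k * K.
    apply: ler_wpM2l; first exact: ltW.
    have := psib i f cf; have := psib j f cf; rewrite !ler_norml /K.
    by move=> /andP[j1 j2] /andP[i1 i2]; lra.
  by rewrite /th mulrBr; lra.
have : gap (th k i) f g < 2 * d by move: hTh; rewrite /gap; lra.
by move=> h; rewrite -(ltr_pM2l (r0 k)); lra.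
Qed.

End sums_of_functionals.

(** * LUR moduli and the gauge *)

Section LUR_moduli.
Context {R : realType} {T : topologicalType}.
Implicit Types (A : set T) (N : (T -> R) -> R).

(** If no [d] works, counterexamples for d = 1 / (n + 1) form a sequence that violates [LUR]. *)
Lemma LUR_sphere_modulus A N : is_norm_on_C A N -> LUR A N ->
  forall x (e : R), CA A x -> N x = 1 -> 0 < e ->
  exists2 d : R, 0 < d & forall z, CA A z -> N z = 1 -> 1 - d < N (mid x z) ->
    N (fun t => x t - z t) < e.
Proof.
move=> [_ _ _ Nh Nt] LN x e cx Nx e0; apply: contrapT => H.
have /choice[z hz] : forall n : nat, exists z, [/\ CA A z, N z = 1,
    1 - n.+1%:R^-1 < N (mid x z) & e <= N (fun t => x t - z t)].
  move=> n; apply: contrapT => Hn; apply: H; exists n.+1%:R^-1 => // z cz Nz zm.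
  by rewrite ltNge; apply/negP => ez; apply: Hn; exists z.
have cz n : CA A (z n) by case: (hz n).
have Nz n : N (z n) = 1 by case: (hz n).
have mid1 n : N (mid x (z n)) <= 1.
  rewrite (_ : mid x (z n) = fun t => 2^-1 * x t + 2^-1 * z n t); last first.
    by apply/funext => t; rewrite /mid; field.
  have c2 (f : T -> R) : CA A f -> CA A (fun t => 2^-1 * f t).
    move=> cf; have := @CA_lin _ _ _ _ _ 2^-1 0 cf cf.
    by congr (CA A _); apply/funext => t; rewrite mul0r addr0.
  apply: le_trans (Nt _ _ (c2 _ cx) (c2 _ (cz n))) _.
  by rewrite !Nh // Nx Nz ger0_norm //; lra.
have /cvgrPdist_lt/(_ _ e0)[m _ hm] : (fun n => N (fun t => x t - z n t)) @ \oo --> (0 : R).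
  apply: LN => //; apply/cvgrPdist_lt => u u0.
  exists (Num.truncn u^-1) => // n /= hn.
  have [_ _ h _] := hz n; change (`|1 - N (mid x (z n))| < u).
  have h1 := mid1 n.
  rewrite ger0_norm ?subr_ge0 //.
  suff nu : n.+1%:R^-1 < u by move: h nu; set q := (_^-1); lra.
  rewrite invf_plt ?posrE //; apply: lt_le_trans (truncnS_gt _) _.
  by rewrite ler_nat ltnS.
have [_ _ _ h] := hz m; have := hm m (leqnn m); rewrite /= sub0r normrN.
move=> h2; suff : e < e by rewrite ltxx.
by apply: le_lt_trans h (le_lt_trans (ler_norm _) h2).
Qed.

(** A small gap of the square makes [N g] close to [N f], so both functions can be normalised and
    compared on the sphere. For [N f = 0] it bounds [N g] directly. *)
Lemma LUR_gap_sqr A N : is_norm_on_C A N -> LUR A N ->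
  forall f (e : R), CA A f -> 0 < e ->
  exists2 d : R, 0 < d & forall g, CA A g ->
    gap (fun f => N f ^+ 2) f g < d -> N (fun t => f t - g t) < e.
Proof.
move=> nN LN f e cf e0; have [_ N0 _ Nh Nt] := nN.
have cs (a : R) h : CA A h -> CA A (fun t => a * h t).
  move=> ch; have := @CA_lin _ _ _ _ _ a 0 ch ch.
  by congr (CA A _); apply/funext => t; rewrite mul0r addr0.
have ca (h k : T -> R) : CA A h -> CA A k -> CA A (fun t => h t + k t).
  move=> ch ck; have := @CA_lin _ _ _ _ _ 1 1 ch ck.
  by congr (CA A _); apply/funext => t; rewrite !mul1r.
have cm (h k : T -> R) : CA A h -> CA A k -> CA A (mid h k).
  move=> ch ck; have := @CA_lin _ _ _ _ _ 2^-1 2^-1 ch ck.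
  by congr (CA A _); apply/funext => t; rewrite /mid; field.
have Nsub h k : CA A h -> CA A k -> N (fun t => h t - k t) <= N h + N k.
  move=> ch ck; have := Nt _ _ ch (cs (-1) _ ck).
  rewrite Nh // normrN1 mul1r; congr (_ <= _).
  by congr N; apply/funext => t; ring.
have mid_le h k : CA A h -> CA A k -> N (mid h k) <= (N h + N k) / 2.
  move=> ch ck; have := Nt _ _ ch ck.
  rewrite (_ : mid h k = fun t => 2^-1 * (h t + k t)); last first.
    by apply/funext => t; rewrite /mid mulrC.
  by rewrite Nh ?ger0_norm //; [lra|exact: ca].
have key h k : CA A h -> CA A k ->
    ((N h - N k) / 2) ^+ 2 <= gap (fun f => N f ^+ 2) h k.
  move=> ch ck; rewrite /gap; have := mid_le _ _ ch ck; have := N0 _ (cm _ _ ch ck).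
  by nra.
have a0 := N0 _ cf; set a := N f in a0.
have [a00|ap] := eqVneq a 0.
  exists (e ^+ 2 / 16); first by rewrite divr_gt0 ?exprn_gt0.
  move=> g cg hg; have := key f g cf cg; have := Nsub _ _ cf cg.
  by have := N0 _ cg; rewrite -/a a00; nra.
have {ap a0} a0 : 0 < a by rewrite lt_neqAle eq_sym ap.
pose x t := a^-1 * f t.
have cx : CA A x by exact: cs.
have Nx : N x = 1 by rewrite Nh // gtr0_norm ?invr_gt0 // mulVf ?gt_eqF.
have ea : 0 < e / (2 * a) by rewrite divr_gt0 ?mulr_gt0.
have [d d0 hd] := LUR_sphere_modulus nN LN cx Nx ea.
(* The three bounds serve in turn to keep [N g] positive, to make the change of norm negligible
   against [e], and to push the normalised midpoint above 1 - d. *)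
pose u := Num.min (a / 2) (Num.min (e / 4) (a * d / 2)).
have u0 : 0 < u by rewrite !lt_min !divr_gt0 ?mulr_gt0.
have ua : u <= a / 2 by rewrite ge_min lexx.
have ue : u <= e / 4 by rewrite !ge_min lexx orbT.
have ud : u <= a * d / 2 by rewrite !ge_min lexx !orbT.
exists (u ^+ 2 / 4); first by rewrite divr_gt0 ?exprn_gt0.
move=> g cg hg; have hk := key f g cf cg; set b := N g in hk.
have [ab1 ab2] : a - b < u /\ b - a < u by rewrite -/a in hk; split; nra.
have b0 : 0 < b by lra.
pose z t := b^-1 * g t.
have cz : CA A z by exact: cs.
have Nz : N z = 1 by rewrite Nh // gtr0_norm ?invr_gt0 // mulVf ?gt_eqF.
have nab : `|a - b| < u by rewrite ltr_norml; apply/andP; split; lra.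
have hm : a - u <= N (mid f g).
  move: hg; rewrite /gap -/a -/b; have := N0 _ (cm _ _ cf cg); nra.
have hm2 : 1 - d < N (mid x z).
  (* With f = a x and g = b z, the midpoint of [f], [g] is a times that of [x], [z] minus ((a - b) /
     2) z. *)
  have : a * N (mid x z) >= N (mid f g) - u / 2.
    have := Nsub _ _ (cs a _ (cm _ _ cx cz)) (cs ((a - b) / 2) _ cz).
    rewrite Nh; last exact: cm.
    rewrite Nh // Nz normrM (gtr0_norm a0) (ger0_norm (_ : 0 <= 2^-1)) //.
    rewrite (_ : (fun t => _ - _) = mid f g); first by lra.
    apply/funext => t; rewrite /mid /x /z; field.
    by rewrite !gt_eqF.
  nra.
have := hd z cz Nz hm2 => hxz.
have : N (fun t => f t - g t) <= a * N (fun t => x t - z t) + `|a - b|.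
  have cxz : CA A (fun t => x t - z t).
    rewrite (_ : (fun t => _) = fun t => 1 * x t + -1 * z t).
      exact: CA_lin.
    by apply/funext => t; ring.
  have := Nt _ _ (cs a _ cxz) (cs (a - b) _ cz).
  rewrite Nh // Nh // Nz mulr1 (gtr0_norm a0).
  rewrite (_ : (fun t => _ + _) = fun t => f t - g t) //.
  by apply/funext => t; rewrite /x /z; field; rewrite !gt_eqF.
move: hxz; rewrite ltr_pdivlMr ?mulr_gt0 // => hxz; lra.
Qed.

End LUR_moduli.

Section gauge.
Context {R : realType} {X : topologicalType}.
Hypothesis cX : compact [set: X].
Implicit Types (f g : X -> R).

(* The norm is the Minkowski gauge of [Psi <= 1]. *)
Lemma gauge_LUR_lsc (Psi : (X -> R) -> R) (C : R) : 1 <= C -> good C Psi ->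
  (forall f, Psi (fun x => - f x) = Psi f) -> Psi (fun=> 0) = 0 ->
  (forall f, continuous f -> nrm f ^+ 2 <= Psi f) ->
  (forall f (e : R), continuous f -> 0 < e -> exists2 d : R, 0 < d &
    forall g, continuous g -> gap Psi f g < d -> forall x, `|f x - g x| <= e) ->
  has_LUR_lsc_norm R [set: X].
Proof.
move=> C1 [cP lP bP] sP P0 nP hP.
have pP f : continuous f -> 0 <= Psi f.
  by move=> cf; apply: le_trans (nP f cf); exact: sqr_ge0.
(* Convexity on the segment from 0 to [f], evenness taking care of the sign. *)
have shrink f (a : R) : continuous f -> `|a| <= 1 ->
    Psi (fun x => a * f x) <= `|a| * Psi f.
  move=> cf; wlog a0 : a / 0 <= a => [W|].
    have [a0|a0] := leP 0 a; first exact: W.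
    move=> a1; have := W (- a); rewrite normrN => /(_ _ a1).
    rewrite -sP (_ : (fun x => - (- a * f x)) = fun x => a * f x); last first.
      by apply/funext => x; ring.
    by apply; rewrite oppr_ge0 ltW.
  rewrite ger0_norm // => a1.
  have := cP f (fun=> 0) a cf (@continuous_const _ _ 0) a0 a1.
  rewrite P0 mulr0 addr0; congr (_ <= _); congr Psi.
  by apply/funext => x; ring.
pose K f := [set t : R | 0 < t /\ Psi (fun x => t^-1 * f x) <= 1].
pose N f := inf (K f).
have K_up f t t' : continuous f -> K f t -> t <= t' -> K f t'.
  move=> cf [t0 Kt] tt'; have t'0 : 0 < t' by exact: lt_le_trans tt'.
  split=> //; have q1 : `|t / t'| <= 1.
    rewrite ger0_norm; last by rewrite divr_ge0 // ltW.
    by rewrite ler_pdivrMr // mul1r.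
  have := shrink _ (t / t') (@continuous_scale _ _ f t^-1 cf) q1.
  rewrite (_ : (fun x => t / t' * _) = fun x => t'^-1 * f x); last first.
    by apply/funext => x; field; rewrite !gt_eqF.
  move=> h; apply: le_trans h _.
  by have := pP _ (@continuous_scale _ _ f t^-1 cf); have := normr_ge0 (t / t'); nra.
(* A function of sup norm at most 1 has [Psi] at most C (1 + 1)^2 = b; shrinking it by 1 / b brings
   [Psi] below 1. *)
pose b := 4 * C.
have b0 : 0 < b by rewrite /b; lra.
have K_big f t : continuous f -> 0 < t -> b * nrm f <= t -> K f t.
  move=> cf t0 bt; split => //.
  have cf' : continuous (fun x => b / t * f x) by exact: continuous_scale.
  have n1 : nrm (fun x => b / t * f x) <= 1.
    apply: nrm_le => // x; rewrite normrM (gtr0_norm (divr_gt0 b0 t0)).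
    rewrite mulrAC ler_pdivrMr // mul1r; apply: le_trans bt.
    by rewrite ler_pM2l // le_nrm.
  have bb : `|b^-1| <= 1.
    by rewrite gtr0_norm ?invr_gt0 // invf_le1 // /b; lra.
  have := shrink _ b^-1 cf' bb.
  rewrite (_ : (fun x => b^-1 * _) = fun x => t^-1 * f x); last first.
    by apply/funext => x; field; rewrite !gt_eqF.
  move=> h; apply: le_trans h _.
  rewrite gtr0_norm ?invr_gt0 // mulrC ler_pdivrMr // mul1r.
  have := bP _ cf'; have := nrm_ge0 cX cf'; have := ler_norm (Psi (fun x => b / t * f x)).
  rewrite /b; set n := nrm _ in n1 *; move=> h1 h2 h3.
  have : (1 + n) ^+ 2 <= 4 by nra.
  nra.
have K_inf f : continuous f -> has_inf (K f).
  move=> cf; split; last by exists 0 => t [/ltW].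
  exists (b * nrm f + 1); apply: K_big => //; last by lra.
  by rewrite ltr_wpDl // mulr_ge0 ?nrm_ge0 // ltW.
have N_le f t : continuous f -> K f t -> N f <= t.
  by move=> cf Kt; apply: ge_inf => //; exists 0 => s [/ltW].
have N_lt f t : continuous f -> N f < t -> K f t.
  move=> cf Nt; have [s Ks st] := inf_lt (K_inf f cf).1 Nt.
  exact: K_up Ks (ltW st).
have N_ge0 f : continuous f -> 0 <= N f.
  by move=> cf; apply: lb_le_inf; [case: (K_inf f cf)|move=> t [/ltW]].
have le_N f x : continuous f -> `|f x| <= N f.
  move=> cf; apply: lb_le_inf; first by case: (K_inf f cf).
  move=> t [t0 Kt]; have cf' := @continuous_scale _ _ f t^-1 cf.
  have := le_nrm cX x cf'; have := nP _ cf'; have := nrm_ge0 cX cf'.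
  rewrite normrM gtr0_norm ?invr_gt0 // => h1 h2 h3.
  have : t^-1 * `|f x| <= 1 by nra.
  by rewrite mulrC ler_pdivrMr // mul1r.
have N_nrm f : continuous f -> N f <= b * nrm f.
  move=> cf; apply/ler_addgt0Pr => e e0; apply: N_le => //; apply: K_big => //.
    by rewrite ltr_wpDl // mulr_ge0 ?nrm_ge0 // ltW.
  by rewrite lerDl ltW.
have N_hom0 (a : R) f : continuous f -> N (fun x => a * f x) <= `|a| * N f.
  move=> cf; apply/ler_addgt0Pr => e e0.
  pose d := e / (2 * (`|a| + 1)).
  have a1 : 0 < `|a| + 1 by rewrite ltr_wpDl.
  have d0 : 0 < d by rewrite divr_gt0 // mulr_gt0.
  have dE : 2 * (d * (`|a| + 1)) = e by rewrite /d; field; rewrite gt_eqF.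
  have Nf := N_ge0 f cf; have an := normr_ge0 a.
  have [t0 Kt] : K f (N f + d) by apply: N_lt => //; rewrite ltrDl.
  set t := N f + d in t0 Kt.
  pose s := `|a| * t + e / 2.
  have s0 : 0 < s by rewrite ltr_wpDl ?divr_gt0 // mulr_ge0 // ltW.
  have Ks : K (fun x => a * f x) s.
    split=> //; have q1 : `|a * t / s| <= 1.
      rewrite !normrM normfV (gtr0_norm s0) (gtr0_norm t0) ler_pdivrMr // mul1r.
      by rewrite lerDl ltW // divr_gt0.
    have := shrink _ (a * t / s) (@continuous_scale _ _ f t^-1 cf) q1.
    rewrite (_ : (fun x => a * t / s * _) = fun x => s^-1 * (a * f x)); last first.
      by apply/funext => x; field; rewrite !gt_eqF.
    move=> h; apply: le_trans h _.
    by have := pP _ (@continuous_scale _ _ f t^-1 cf); have := normr_ge0 (a * t / s); nra.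
  apply: le_trans (N_le _ _ (continuous_scale (a := a) cf) Ks) _.
  by rewrite /s /t; nra.
exists N; split.
- split.
  + move=> f g fg; congr N; apply/funext => x; apply: fg; exact: in_setT.
  + by move=> f /CA_continuous; exact: N_ge0.
  + move=> f /CA_continuous cf Nf x _; apply/eqP; rewrite -normr_le0 -Nf.
    exact: le_N.
  + move=> a f /CA_continuous cf; apply/eqP; rewrite eq_le N_hom0 //=.
    have [->|a0] := eqVneq a 0.
      by rewrite normr0 mul0r N_ge0 //; exact: continuous_scale.
    rewrite mulrC -ler_pdivlMr ?normr_gt0 //.
    have := N_hom0 a^-1 _ (continuous_scale (a := a) cf).
    rewrite (_ : (fun x => _) = f); last by apply/funext => x; rewrite mulKf.
    by rewrite normfV mulrC.
  + move=> f g /CA_continuous cf /CA_continuous cg.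
    apply/ler_addgt0Pr => e e0; have e2 : 0 < e / 2 by rewrite divr_gt0.
    have [s0 Ks] : K f (N f + e / 2) by apply: N_lt => //; rewrite ltrDl.
    have [t0 Kt] : K g (N g + e / 2) by apply: N_lt => //; rewrite ltrDl.
    rewrite (_ : N f + N g + e = N f + e / 2 + (N g + e / 2)); last by field.
    set s := N f + e / 2 in s0 Ks *; set t := N g + e / 2 in t0 Kt *.
    have st : 0 < s + t by rewrite addr_gt0.
    apply: N_le; [exact: continuous_add|split => //].
    have h0 : 0 <= s / (s + t) by rewrite divr_ge0 // ltW.
    have h1 : s / (s + t) <= 1 by rewrite ler_pdivrMr // mul1r lerDl ltW.
    have := cP _ _ _ (@continuous_scale _ _ f s^-1 cf)
      (@continuous_scale _ _ g t^-1 cg) h0 h1.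
    rewrite (_ : (fun x => _ + _) = fun x => (s + t)^-1 * (f x + g x)); last first.
      by apply/funext => x; field; rewrite !gt_eqF.
    by nra.
- exists 1, b; split => // f /CA_continuous cf; split; last exact: N_nrm.
  by rewrite mul1r; apply: nrm_le => [|x]; [exact: N_ge0|exact: le_N].
(* Here (1 + s) h is the convex combination of 2 h and h with weight s, and [Psi] at 2 h is at most
   C (1 + 2)^2 = 9 C. *)
- have ray h (s : R) : continuous h -> (forall x, `|h x| <= 1) -> 0 <= s -> s <= 1 ->
      Psi (fun x => (1 + s) * h x) <= Psi h + s * (9 * C).
    move=> ch h1 s0 s1.
    have c2 := @continuous_scale _ _ h 2 ch.
    have := cP _ _ s c2 ch s0 s1.
    rewrite (_ : (fun x => _ + _) = fun x => (1 + s) * h x); last first.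
      by apply/funext => x; ring.
    have : nrm (fun x => 2 * h x) <= 2.
      apply: nrm_le => // x; rewrite normrM ger0_norm //; have := h1 x; lra.
    have := nrm_ge0 cX c2; have := bP _ c2; have := pP _ ch.
    have := ler_norm (Psi (fun x => 2 * h x)).
    set n := nrm _; move=> i1 i2 i3 i4 i5.
    have : (1 + n) ^+ 2 <= 9 by nra.
    move=> i6; have : Psi (fun x => 2 * h x) <= 9 * C by nra.
    by nra.
  (* The infimum defining [N] only gives [Psi] at most 1 at x / (1 + s) for s > 0; [ray] lets s tend
     to 0. *)
  have sphere x : continuous x -> N x = 1 -> Psi x <= 1.
    move=> cx Nx; apply/ler_addgt0Pr => e e0.
    pose s := Num.min 1 (e / (9 * C)).
    have s0 : 0 < s by rewrite lt_min ltr01 divr_gt0 // mulr_gt0 //; lra.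
    have s1 : s <= 1 by rewrite ge_min lexx.
    have se : s * (9 * C) <= e.
      by rewrite -ler_pdivlMr; [rewrite ge_min lexx orbT|lra].
    have [|_ Kx] := N_lt x (1 + s) cx; first by rewrite Nx ltrDl.
    have := ray (fun t => (1 + s)^-1 * x t) s (continuous_scale cx) _ (ltW s0) s1.
    rewrite (_ : (fun t => (1 + s) * _) = x); last first.
      by apply/funext => t; rewrite mulrA divff ?mul1r // gt_eqF //; lra.
    move=> /(_ _)/le_trans; apply; last by lra.
    move=> t; rewrite normrM ger0_norm ?invr_ge0; last by lra.
    rewrite mulrC ler_pdivrMr ?mul1r; last by lra.
    by have := le_N x t cx; rewrite Nx; lra.
  move=> x xs /CA_continuous cx cxs' Nx Nxs.
  have cxs n : continuous (xs n) by apply/CA_continuous.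
  move=> hm; apply/cvgrPdist_lt => e e0.
  have eb : 0 < e / (2 * b) by rewrite divr_gt0 // mulr_gt0.
  have [d d0 hd] := hP x _ cx eb.
  (* A midpoint of norm above 1 / (1 + s) has [Psi] above 1 - 9 C s >= 1 - d by [ray], while both
     endpoints have [Psi] at most 1: the gap is below [d]. *)
  pose s := Num.min 1 (d / (9 * C)).
  have s0 : 0 < s by rewrite lt_min ltr01 divr_gt0 // mulr_gt0 //; lra.
  have s1 : s <= 1 by rewrite ge_min lexx.
  have sd : s * (9 * C) <= d.
    by rewrite -ler_pdivlMr; [rewrite ge_min lexx orbT|lra].
  have r0 : 0 < 1 - (1 + s)^-1 by rewrite subr_gt0 invf_lt1; lra.
  have /cvgrPdist_lt/(_ _ r0)[m _ Hm] := hm; exists m => // n /= mn.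
  have Nm : `|1 - N (mid x (xs n))| < 1 - (1 + s)^-1 := Hm n mn.
  have cm := continuous_mid cx (cxs n).
  have Nm1 : (1 + s)^-1 < N (mid x (xs n)).
    by have := ler_norm (1 - N (mid x (xs n))); lra.
  have m1 t : `|mid x (xs n) t| <= 1.
    have := le_N x t cx; have := le_N _ t (cxs n); rewrite Nx Nxs /mid !ler_norml.
    by move=> /andP[? ?] /andP[? ?]; apply/andP; split; lra.
  have Pm : 1 < Psi (fun t => (1 + s) * mid x (xs n) t).
    rewrite ltNge; apply/negP => Pm.
    have : K (mid x (xs n)) (1 + s)^-1.
      by split; [rewrite invr_gt0; lra|rewrite invrK].
    by move=> /(N_le _ _ cm); rewrite leNgt Nm1.
  have := ray _ s cm m1 (ltW s0) s1 => h1.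
  have := sphere _ cx Nx; have := sphere _ (cxs n) (Nxs n) => h2 h3.
  have h4 : gap Psi x (xs n) < d by rewrite /gap; lra.
  have := hd _ (cxs n) h4 => h5.
  have cd := continuous_sub cx (cxs n).
  have : nrm (fun t => x t - xs n t) <= e / (2 * b) by apply: nrm_le => //; exact: ltW.
  have := N_nrm _ cd; rewrite sub0r normrN ger0_norm; last exact: N_ge0.
  move=> i1; rewrite -(ler_pM2l b0) => i2.
  have : b * (e / (2 * b)) = e / 2 by field; rewrite gt_eqF.
  by lra.
- move=> f /CA_continuous cf e e0.
  have [Ne|eN] := ltP (N f) e.
    exists [::], 1; split => // g /CA_continuous cg _.
    by have := N_ge0 g cg; lra.
  (* Since [t] lies below the infimum, [Psi] exceeds 1 at f / t; lower semicontinuity with the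
     excess as tolerance keeps it above 1 at g / t. *)
  pose t := N f - e / 2.
  have t0 : 0 < t by rewrite /t; lra.
  have Pt : 1 < Psi (fun x => t^-1 * f x).
    rewrite ltNge; apply/negP => Pm.
    by have /(N_le _ _ cf) : K f t by []; rewrite leNgt /t; move=> /negP; apply; lra.
  have cft := @continuous_scale _ _ f t^-1 cf.
  have P1 : 0 < Psi (fun x => t^-1 * f x) - 1 by rewrite subr_gt0.
  have [F [d [d0 hF]]] := lP _ cft _ P1.
  exists F, (d * t); split => [//||g /CA_continuous cg hg]; first exact: mulr_gt0.
  have : 1 < Psi (fun x => t^-1 * g x).
    have := hF _ (@continuous_scale _ _ g t^-1 cg); rewrite subKr; apply.
    move=> u uF; rewrite -mulrBr normrM gtr0_norm ?invr_gt0 // mulrC.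
    by rewrite ltr_pdivrMr // hg.
  move=> Pg; suff : t <= N g by rewrite /t; lra.
  rewrite leNgt; apply/negP => /(N_lt _ _ cg)[_]; lra.
Qed.

End gauge.

(** * Compact spaces and fully closed maps *)

Section compact_spaces.
Context {R : realType}.

Lemma finite_subcover (T : topologicalType) (I : choiceType) (V : I -> set T) :
  compact [set: T] -> (forall i, open (V i)) -> (forall x, exists i, V i x) ->
  exists s : seq I, forall x, exists2 i, i \in s & V i x.
Proof.
move=> cT oV cV; have [[y0 _]|T0] := pselect ([set: T] !=set0); last first.
  by exists [::] => x; exfalso; apply: T0; exists x.
pose T' : ptopologicalType := HB.pack T (isPointed.Build T y0).
have : compact [set: T'] by [].
rewrite compact_cover => /(_ I setT V)[i _|x _|D _ hD]; first exact: oV.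
  by have [i Vi] := cV x; exists i.
by exists (finmap.enum_fset D) => x; have [i iD Vi] := hD x Logic.I; exists i.
Qed.

Lemma urysohn_function (T : topologicalType) (A B : set T) :
  compact_hausdorff T -> closed A -> closed B -> A `&` B = set0 ->
  exists h : T -> R, [/\ continuous h, (forall x, 0 <= h x),
    (forall x, A x -> h x = 0) & (forall x, B x -> h x = 1)].
Proof.
move=> [hT cT] cA cB AB.
have /(@normal_separatorP R)/(_ A B cA cB AB) := compact_normal hT cT.
move=> /(@uniform_separatorP _ R)[h [ch h01 hA hB]]; exists h; split => //.
- by move=> x; have := h01 (h x) (ex_intro2 _ _ x Logic.I erefl); rewrite /= in_itv /= => /andP[].
- by move=> x Ax; apply: hA; exists x.
- by move=> x Bx; apply: hB; exists x.
Qed.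

Lemma continuous_sum (T : topologicalType) (I : Type) (s : seq I)
  (h : I -> T -> R) : (forall i, continuous (h i)) ->
  continuous (fun x => \sum_(i <- s) h i x).
Proof.
move=> ch; elim: s => [|i s IH].
  rewrite (_ : (fun _ => _) = fun=> 0); first exact: continuous_const.
  by apply/funext => x; rewrite big_nil.
rewrite (_ : (fun _ => _) = fun x => h i x + \sum_(i <- s) h i x).
  exact: continuous_add.
by apply/funext => x; rewrite big_cons.
Qed.

(** Points are added one at a time, correcting with a Urysohn function that vanishes at the earlier
    ones; a truncation then restores the bound. *)
Lemma finite_interpolation (T : topologicalType) (F : seq T) (u : T -> R) (M : R) :
  compact_hausdorff T -> 0 <= M -> (forall y, y \in F -> `|u y| <= M) ->
  exists q : T -> R, [/\ continuous q, (forall y, y \in F -> q y = u y) &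
    forall y, `|q y| <= M].
Proof.
move=> hT M0 uM.
have [q cq qu] : exists2 q : T -> R, continuous q &
    forall y, y \in F -> q y = u y.
  elim: F {uM} => [|a F [q cq qu]]; first by exists (fun=> 0).
  have [aF|aF] := boolP (a \in F).
    by exists q => // y; rewrite inE => /predU1P[->|/qu//]; exact: qu.
  have acT := hausdorff_accessible hT.1.
  have clF : closed [set` F].
    by apply: ((@accessible_finite_set_closed T).1 acT); apply/finite_seqP; exists F.
  have [||h [ch _ hF ha]] := @urysohn_function T [set` F] [set a] hT clF.
  - exact: accessible_closed_set1.
  - by apply/seteqP; split => // x [/= xF xa]; move: aF; rewrite -xa xF.
  exists (fun y => q y + (u a - q a) * h y).
    by apply: continuous_add => //; exact: continuous_scale.
  move=> y; rewrite inE => /predU1P[->|yF].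
    by rewrite ha // mulr1 addrC subrK.
  by rewrite hF // mulr0 addr0 qu.
(* This formula truncates [q] to [-M, M]. *)
pose r y := 2^-1 * `|q y + M| + - 2^-1 * `|q y - M|.
have nc (v : T -> R) : continuous v -> continuous (fun y => `|v y|).
  by move=> cv y; apply: cvg_norm; exact: cv.
exists r; split.
- apply: continuous_lin; apply: nc.
    by apply: continuous_add => //; exact: continuous_const.
  by apply: continuous_sub => //; exact: continuous_const.
- move=> y yF; have := uM y yF; rewrite -(qu y yF) ler_norml => /andP[h1 h2].
  by rewrite /r ger0_norm ?ler0_norm; lra.
- move=> y; rewrite /r ler_norml; apply/andP.
  by case: (ger0P (q y + M)); case: (ger0P (q y - M)) => h1 h2; split; lra.
Qed.

Lemma image_closed (X Y : topologicalType) (p : X -> Y) (F : set X) :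
  compact [set: X] -> hausdorff_space Y -> continuous p -> closed F ->
  closed (p @` F).
Proof.
move=> cX hY cp cF; apply: compact_closed => //; apply: continuous_compact.
  exact: continuous_subspaceT.
exact: subclosed_compact cF cX _.
Qed.

End compact_spaces.

Section fibre_oscillation.
Context {R : realType} {X Y : topologicalType} (p : X -> Y).
Hypotheses (hX : compact_hausdorff X) (hY : compact_hausdorff Y)
  (cp : continuous p) (sp : forall y, exists x, p x = y).
Implicit Types f g : X -> R.

(** The least such [r] is equivalent to the norm of the class of [f] in C(X) / C(Y), by [fosc_bound]
    and [fosc_approx]. *)
Definition fosc f (r : R) := forall s t, p s = p t -> `|f s - f t| <= r.

Lemma fosc_add f g (a b : R) : fosc f a -> fosc g b ->
  fosc (fun x => f x + g x) (a + b).
Proof.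
move=> fa gb s t st; rewrite (_ : _ - _ = (f s - f t) + (g s - g t)); last by ring.
by apply: le_trans (ler_normD _ _) _; rewrite lerD ?fa ?gb.
Qed.

Lemma fosc_sub f g (a b : R) : fosc f a -> fosc g b ->
  fosc (fun x => f x - g x) (a + b).
Proof.
move=> fa gb s t st; rewrite (_ : _ - _ = (f s - f t) - (g s - g t)); last by ring.
by apply: le_trans (ler_normB _ _) _; rewrite lerD ?fa ?gb.
Qed.

Lemma fosc_le f (a b : R) : a <= b -> fosc f a -> fosc f b.
Proof. by move=> ab fa s t st; apply: le_trans ab; exact: fa. Qed.

Lemma fosc_bound f (a : R) : (forall x, `|f x| <= a) -> fosc f (2 * a).
Proof.
move=> fa s t _; apply: le_trans (ler_normB _ _) _.
by have := fa s; have := fa t; lra.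
Qed.

(** Continuity of the factor holds because [p] is a closed map: the preimage of a closed set is the
    image under [p] of a closed set. *)
Lemma fosc0_factor f : continuous f -> fosc f 0 ->
  exists2 q : Y -> R, continuous q & forall x, f x = q (p x).
Proof.
move=> cf f0; have [s hs] := choice sp.
have fE x : f x = f (s (p x)).
  apply/eqP; rewrite -subr_eq0 -normr_le0; apply: f0; exact/esym/hs.
exists (f \o s) => //; apply/continuous_closedP => C cC.
rewrite (_ : _ @^-1` C = p @` (f @^-1` C)).
  apply: image_closed => //; [exact: hX.2|exact: hY.1|].
  by move/continuous_closedP: cf => /(_ C cC).
apply/seteqP; split => [y Cy|_ [x Cx <-]]; first by exists (s y).
by rewrite /preimage /= -fE.
Qed.

(** A partition of unity argument on Y: [f] is within 2 r of [f (s y)] on all fibres over a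
    neighbourhood of [y], since [p] is closed, and the values [f (s y)] are averaged with Urysohn
    weights supported there. *)
Lemma fosc_approx f (r : R) : continuous f -> 0 < r -> fosc f r ->
  exists2 q : Y -> R, continuous q & forall x, `|f x - q (p x)| <= 2 * r.
Proof.
move=> cf r0 fr; have [s hs] := choice sp.
have [cX hY1] := (hX.2, hY.1).
pose D y : set X := [set x | 2 * r <= `|f x - f (s y)|].
have cD y : closed (D y).
  have cd : continuous (fun x => `|f x - f (s y)|).
    move=> x; apply: cvg_norm.
    exact: (continuous_sub cf (@continuous_const R X (f (s y)))).
  by move/continuous_closedP: cd => /(_ _ (@closed_ge R (2 * r))).
have yD y : p @` D y `&` [set y] = set0.
  apply/seteqP; split => // _ [[x Dx <-] /= xy].
  have : `|f x - f (s y)| <= r by apply: fr; rewrite xy hs.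
  move=> h; have : 2 * r <= r by exact: le_trans h.
  by rewrite leNgt => /negP; apply; lra.
have ac := hausdorff_accessible hY1.
have /choice[h hh] : forall y, exists h : Y -> R, [/\ continuous h,
    (forall x, 0 <= h x), (forall x, (p @` D y) x -> h x = 0) & h y = 1].
  move=> y; have [|h [h1 h2 h3 h4]] :=
      @urysohn_function R Y _ [set y] hY (image_closed cX hY1 cp (cD y)) _ (yD y).
    exact: accessible_closed_set1.
  by exists h; split => //; exact: h4.
have [|y|F hF] := @finite_subcover Y Y (fun y => [set z | 0 < h y z]) hY.2.
- move=> y; have [ch _ _ _] := hh y.
  by apply: open_comp (@open_gt R 0) => z _; exact: ch.
- by exists y; have [_ _ _ /= ->] := hh y.
have h0 i y : 0 <= h i y by have [_ h0 _ _] := hh i.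
pose W y := \sum_(i <- F) h i y.
have W0 y : 0 < W y.
  have [i iF hi] := hF y; rewrite /W (big_rem i) //=.
  by rewrite ltr_wpDr // sumr_ge0.
have cW : continuous W by apply: continuous_sum => i; have [] := hh i.
exists (fun y => (\sum_(i <- F) f (s i) * h i y) / W y).
  move=> y; apply: cvgM.
    have cS : continuous (fun y => \sum_(i <- F) f (s i) * h i y).
      apply: (@continuous_sum R Y Y F (fun i y => f (s i) * h i y)) => i.
      by apply: continuous_scale; have [] := hh i.
    exact: cS.
  by apply: cvgV; [rewrite gt_eqF|exact: cW].
move=> x; rewrite -(ler_pM2r (W0 (p x))).
rewrite -[X in _ * X <= _](gtr0_norm (W0 (p x))) -normrM mulrBl divfK ?gt_eqF //.
rewrite /W !mulr_sumr -sumrB; apply: le_trans (ler_norm_sum _ _ _) _.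
apply: ler_sum => i _; rewrite -mulrBl normrM (ger0_norm (h0 _ _)).
have [lt|ge] := ltP `|f x - f (s i)| (2 * r); first by rewrite ler_wpM2r // ltW.
by have [_ _ hz _] := hh i; rewrite (hz (p x)) ?mulr0.
Qed.

(** Cut the range of [f] at levels e / 2 apart. A fibre of oscillation above [e] meets both sides of
    some band, hence two disjoint closed sets, and there are finitely many bands. *)
Lemma fully_closed_fosc_finite f (e : R) : fully_closed p -> continuous f ->
  0 < e -> finite_set [set y | exists s t, [/\ p s = y, p t = y & e < `|f s - f t|]].
Proof.
move=> fp cf e0; have cX := hX.2; set M := nrm f.
have fM x : `|f x| <= M by exact: le_nrm.
pose a (j : nat) : R := j%:R * (e / 2) - M.
pose L j : set X := [set x | f x <= a j].
pose U j : set X := [set x | a j + e / 2 <= f x].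
have cf' := (continuous_closedP f).1 cf.
have fin j : finite_set (p @` L j `&` p @` U j).
  apply: fp; [exact: (cf' _ (@closed_le R (a j)))|exact: (cf' _ (@closed_ge R (a j + e / 2)))|].
  apply/seteqP; split => // x []; rewrite /L /U /= => h1 h2.
  have : a j < a j by lra.
  by rewrite ltxx.
pose n := (Num.truncn (2 * M / (e / 2) + 1)).+1.
have e2 : 0 < e / 2 by rewrite divr_gt0.
apply: (@sub_finite_set _ _ (\bigcup_(j in `I_n) (p @` L j `&` p @` U j))); last first.
  by apply: bigcup_finite => // ; exact: finite_II.
have main s t : p s = p t -> e < f t - f s ->
    (\bigcup_(j in `I_n) (p @` L j `&` p @` U j)) (p s).
  move=> st est; pose q := (f s + M) / (e / 2).
  have qE : q * (e / 2) = f s + M by rewrite divfK // gt_eqF.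
  have := fM s; rewrite ler_norml => /andP[s1 s2].
  have q0 : 0 <= q by apply: divr_ge0 (ltW e2); lra.
  (* Rounding up puts level [j] strictly above [f s] by at most e / 2, so the band ends at most [e]
     above [f s], below [f t]. *)
  have /andP[q1 q2] := truncn_itv q0; set j := (Num.truncn q).+1 in q2.
  have jq : j%:R <= q + 1 by rewrite /j -natr1 lerD2r.
  exists j.
    rewrite /= /n -(ltr_nat R); apply: le_lt_trans jq _.
    apply: le_lt_trans (truncnS_gt _); rewrite lerD2r /q.
    by rewrite ler_pM2r ?invr_gt0 //; lra.
  split; [exists s => //|exists t => //].
    by rewrite /L /a /=; have := ltW q2; rewrite -(ler_pM2r e2); lra.
  by rewrite /U /a /=; move: jq; rewrite -(ler_pM2r e2); lra.
move=> _ [s [t [<- ts st]]]; have [h|h] := leP (f s) (f t).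
  by apply: (main s t) => //; move: st; rewrite distrC ger0_norm // subr_ge0.
by rewrite -ts; apply: (main t s) => //; move: st; rewrite gtr0_norm // subr_gt0.
Qed.

End fibre_oscillation.

(** * Oscillations on fibres *)

Lemma sum_const_seq {R : pzRingType} {T : Type} (A : seq T) (c : R) :
  \sum_(y <- A) c = (size A)%:R * c.
Proof.
elim: A => [|y A IH]; first by rewrite big_nil mul0r.
by rewrite big_cons IH /= -natr1 mulrDl mul1r addrC.
Qed.

(** After subtraction of the threshold, terms of [B] outside [A] are nonpositive and terms of [A]
    nonnegative, so passing from [B] to [A] can only increase the sum. *)
Lemma sum_le_top {R : realType} {T : eqType} (A B : seq T) (o : T -> R) (e : R) :
  uniq A -> uniq B -> (forall y, y \in B -> y \notin A -> o y <= e) ->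
  (forall y, y \in A -> e <= o y) ->
  \sum_(y <- B) o y <= \sum_(y <- A) (o y - e) + (size B)%:R * e.
Proof.
move=> uA uB oB oA.
have -> : \sum_(y <- B) o y = \sum_(y <- B) (o y - e) + (size B)%:R * e.
  by rewrite sumrB sum_const_seq subrK.
rewrite lerD2r (bigID (mem A)) [leRHS](bigID (mem B)) /=; apply: lerD.
  rewrite -big_filter -[leRHS]big_filter le_eqVlt; apply/orP; left; apply/eqP.
  apply: perm_big; apply: uniq_perm; rewrite ?filter_uniq // => y.
  by rewrite !mem_filter andbC.
apply: (@le_trans _ _ 0).
  by rewrite big_seq_cond; apply: sumr_le0 => y /andP[yB yA]; rewrite subr_le0 oB.
by rewrite big_seq_cond; apply: sumr_ge0 => y /andP[yA yB]; rewrite subr_ge0 oA.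
Qed.

Section fibres.
Context {R : realType} {X Y : topologicalType} (p : X -> Y).
Hypotheses (hX : compact_hausdorff X) (hY : compact_hausdorff Y)
  (cp : continuous p) (sp : forall y, exists x, p x = y).
Implicit Types f g : X -> R.

Lemma sn_weaken (C D : R) (S : (X -> R) -> R) : C <= D -> lsc_seminorm C S -> lsc_seminorm D S.
Proof.
move=> CD [S0 Sh St Sb Sl]; split => // f cf; apply: le_trans (Sb f cf) _.
by apply: ler_wpM2r => //; apply: nrm_ge0 => //; exact: hX.2.
Qed.

(** Indexing by pairs in the fibre makes this a supremum of the seminorms of [sn_diff], so [sn_sup]
    applies. *)
Definition osc (y : Y) f : R :=
  sup (range (fun st : {st : X * X | p st.1 = y /\ p st.2 = y} =>
    `|f (sval st).1 - f (sval st).2|)).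

Lemma osc_sup y : (forall f, continuous f ->
    has_sup (range (fun st : {st : X * X | p st.1 = y /\ p st.2 = y} =>
      `|f (sval st).1 - f (sval st).2|))) /\ lsc_seminorm 2 (osc y).
Proof.
have [x px] := sp y.
have i0 : {st : X * X | p st.1 = y /\ p st.2 = y} by exists (x, x).
by apply: (sn_sup i0 (S := fun st f => `|f (sval st).1 - f (sval st).2|)) => i;
  apply: sn_diff; exact: hX.2.
Qed.

Lemma le_osc y f s t : continuous f -> p s = y -> p t = y ->
  `|f s - f t| <= osc y f.
Proof.
move=> cf ps pt; have [hs _] := osc_sup y.
apply: (sup_upper_bound (hs f cf)).
by exists (exist (fun st : X * X => p st.1 = y /\ p st.2 = y) (s, t) (conj ps pt)).
Qed.

Lemma osc_le y f (r : R) : continuous f ->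
  (forall s t, p s = y -> p t = y -> `|f s - f t| <= r) -> osc y f <= r.
Proof.
move=> cf h; have [hs _] := osc_sup y.
by apply: ge_sup; [case: (hs f cf)|move=> _ [[[s t] /= [ps pt]] _ <-]; exact: h].
Qed.

(** The equivalence constants depend on the fibre. Rescaling the squared norm by b^-2 gives a growth
    constant common to all fibres, needed for suprema over families of fibres. *)
Lemma fibre_functional y : has_LUR_lsc_norm R (p @^-1` [set y]) ->
  exists2 H : (X -> R) -> R, good 1 H & forall f (e : R), continuous f -> 0 < e ->
    exists2 d : R, 0 < d & forall g, continuous g -> gap H f g < d ->
      forall x, p x = y -> `|f x - g x| <= e.
Proof.
set A := p @^-1` [set y]; have cX := hX.2.
move=> [N [nN [a [b [a0 b0 ab]]] LN lN]].
have cA : compact A.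
  apply: subclosed_compact cX _ => //.
  move/continuous_closedP: (cp); apply; apply: accessible_closed_set1.
  exact: hausdorff_accessible hY.1.
have toA f : continuous f -> CA A f by exact: continuous_subspaceT.
have [_ N0 _ Nh Nt] := nN.
have sN : lsc_seminorm b N.
  split.
  - by move=> f /toA; exact: N0.
  - by move=> r f /toA; exact: Nh.
  - by move=> f g /toA cf /toA; exact: Nt.
  - move=> f cf; apply: le_trans (ab f (toA _ cf)).2 _; rewrite ler_pM2l //.
    by apply: supnorm_le => [|x _]; [exact: nrm_ge0|exact: le_nrm].
  - move=> f cf e e0; have [F [d [FA d0 h]]] := lN f (toA _ cf) e e0.
    by exists F, d; split => // g /toA; exact: h.
exists (fun f => b ^- 2 * N f ^+ 2).
  have b2 : 0 <= b ^- 2 by rewrite invr_ge0 exprn_ge0 // ltW.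
  have := good_scale b2 (sn_sqr cX (ltW b0) sN).
  by rewrite mulVf // expf_neq0 // gt_eqF.
move=> f e cf e0.
have [d d0 hd] := LUR_gap_sqr nN LN (toA _ cf) (mulr_gt0 a0 e0).
have b2 : 0 < b ^- 2 by rewrite invr_gt0 exprn_gt0.
exists (b ^- 2 * d); first exact: mulr_gt0.
move=> g cg hg x px; have cfg := continuous_sub cf cg.
have : gap (fun f => N f ^+ 2) f g < d.
  rewrite -(ltr_pM2l b2); apply: le_lt_trans hg.
  by rewrite /gap le_eqVlt; apply/orP; left; apply/eqP; field; rewrite gt_eqF.
move=> /(hd g (toA _ cg)) h; rewrite -(ler_pM2l a0); apply: ltW.
apply: le_lt_trans h; apply: le_trans (ab _ (toA _ cfg)).1; rewrite ler_pM2l //.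
by apply: (le_supnorm (f := fun x => f x - g x) cA) => //; exact: toA.
Qed.

Hypothesis fp : fully_closed p.

Lemma large_osc_seq f (e : R) : continuous f -> 0 < e ->
  exists A : seq Y, [/\ uniq A, (forall y, y \in A -> e < osc y f) &
    forall y, y \notin A -> osc y f <= e].
Proof.
move=> cf e0.
have /finite_seqP[A hA] := fully_closed_fosc_finite hX fp cf e0.
have hA' y : y \in undup A <->
    exists s t, [/\ p s = y, p t = y & e < `|f s - f t|].
  rewrite mem_undup; split=> [yA|h].
    by have : [set` A] y by []; rewrite -hA.
  by have : [set` A] y by rewrite -hA.
exists (undup A); split; first exact: undup_uniq.
- move=> y /hA'[s [t [ps pt]]] /lt_le_trans; apply; exact: le_osc.
- move=> y yA; apply: osc_le => // s t ps pt; rewrite leNgt; apply/negP => h.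
  by move/negP: yA; apply; apply/hA'; exists s, t.
Qed.

Let fam (m : nat) := {A : seq Y | uniq A && (size A <= m)%N}.
Let fam0 m : fam m. Proof. by exists [::]. Defined.
Let osc_sum m (A : fam m) f := \sum_(y <- sval A) osc y f.

Let osc_sumP m (A : fam m) : lsc_seminorm (2 * m%:R) (osc_sum A).
Proof.
have /andP[_ sA] := svalP A; rewrite /osc_sum.
apply: (@sn_weaken (2 * (size (sval A))%:R)); first by rewrite ler_pM2l // ler_nat.
elim: (sval A) => [|y B IH].
  rewrite mulr0 (_ : (fun _ => _) = fun=> 0); first exact: sn_zero.
  by apply/funext => f; rewrite big_nil.
have := sn_add (osc_sup y).2 IH; rewrite /= -[(size B).+1%:R]natr1 mulrDr mulr1 addrC.
by congr lsc_seminorm; apply/funext => f; rewrite big_cons.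
Qed.

(** The sum of the [m] largest fibre oscillations. *)
Let osc_max m f := sup (range (fun A : fam m => osc_sum A f)).

(** The functionals [M m] force convergence on the finitely many fibres where [f] oscillates a lot.
    The squares of [osc_max m] control the rest: a new large oscillation of [g] elsewhere would
    raise the sum of its largest oscillations. *)
Lemma osc_functional : (forall y, has_LUR_lsc_norm R (p @^-1` [set y])) ->
  exists2 G : (X -> R) -> R, good 1 G &
    forall f (e : R), continuous f -> 0 < e ->
    exists2 d : R, 0 < d & forall g, continuous g -> gap G f g < d ->
      fosc p (fun x => f x - g x) e.
Proof.
move=> hN; have cX := hX.2.
have /choice[H hH] : forall y, exists H : (X -> R) -> R, good 1 H /\
    forall f (e : R), continuous f -> 0 < e -> exists2 d : R, 0 < d &
      forall g, continuous g -> gap H f g < d ->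
        forall x, p x = y -> `|f x - g x| <= e.
  by move=> y; have [H gH hH] := fibre_functional (hN y); exists H.
pose hsum m (A : fam m) f := \sum_(y <- sval A) H y f.
have ghsum m (A : fam m) : good (2 * m%:R + 1) (hsum m A).
  have /andP[_ sA] := svalP A; rewrite /hsum.
  apply: (@good_weaken _ _ (size (sval A))%:R).
    have : (size (sval A))%:R <= m%:R :> R by rewrite ler_nat.
    by move: (ler0n R m); move: _%:R _%:R => a b; lra.
  elim: (sval A) => [|y B IH].
    rewrite (_ : (fun _ => _) = fun=> 0); last by apply/funext => f; rewrite big_nil.
    by rewrite -[X in good X](@normr0 _ R); exact: good_cst.
  have := good_add (hH y).1 IH; rewrite /= addrC natr1.
  by congr good; apply/funext => f; rewrite big_cons.
have C0 m : 0 < 2 * m%:R + 1 :> R by have := ler0n R m; lra.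
have gphi m (A : fam m) : good (2 * m%:R + 1) (osc_sum A).
  have m0 : 0 <= 2 * m%:R :> R by rewrite mulr_ge0.
  by apply: good_weaken (sn_good cX m0 (osc_sumP A)); rewrite lerDl.
have /choice[M hM] : forall m, exists G, good 1 G /\
    forall f (c e : R), continuous f -> 0 < c -> 0 < e ->
    exists2 d : R, 0 < d & forall g, continuous g -> gap G f g < d ->
      exists2 A : fam m, (forall B : fam m, osc_sum B f <= osc_sum A f + c) &
        gap (hsum m A) f g < e.
  move=> m.
  have [||G gG hG] := good_master cX (i0 := fam0 m) (C0 m) (fun A => good_cvx (gphi m A))
    (fun A => good_lsc (gphi m A)) _ _ (ghsum m).
  - by move=> A f cf; apply: le_trans (ler_norm _) (good_bnd (gphi m A) cf).
  - by move=> f cf; have := good_bnd (gphi m (fam0 m)) cf; rewrite ler_norml => /andP[].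
  by exists G.
have smax m := sn_sup (fam0 m) (@osc_sumP m).
have [|G [gG _ _ _ hG]] := good_sum_countable cX
  (H := fun i : nat * bool => if i.2 then M i.1 else fun f => osc_max i.1 f ^+ 2).
  move=> [m []] /=; first by exists 1; exact: (hM m).1.
  by exists ((2 * m%:R) ^+ 2); apply: sn_sqr (smax m).2 => //; rewrite mulr_ge0.
exists G => //.
have on_fibre f (e : R) y : continuous f -> 0 < e -> 0 < osc y f ->
    exists2 d : R, 0 < d & forall g, continuous g -> gap G f g < d ->
      forall x, p x = y -> `|f x - g x| <= e.
  move=> cf e0 oy; pose r := osc y f / 2.
  have r0 : 0 < r by rewrite divr_gt0.
  have [A [uA oA onA]] := large_osc_seq cf r0.
  have yA : y \in A.
    by apply: contraT => /onA; rewrite leNgt /r => /negP[]; lra.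
  have [d1 d10 hd1] := (hH y).2 f e cf e0.
  have [d2 d20 hd2] := (hM (size A)).2 f (r / 2) d1 cf ltac:(lra) d10.
  have [c [c0 hc]] := hG (size A, true).
  exists (c * d2); first exact: mulr_gt0.
  move=> g cg hg; apply: hd1 => //.
  have [|B hB gB] := hd2 g cg.
    by rewrite -(ltr_pM2l c0); apply: le_lt_trans (hc f g cf cg) hg.
  have PA : uniq A && (size A <= size A)%N by rewrite uA leqnn.
  have := hB (exist _ A PA); rewrite /osc_sum /=.
  case: B gB {hB} => B /= PB; rewrite /hsum /=; have /andP[uB sB] := PB.
  (* A family that misses [y] falls short of [A] by at least osc y f - r = r, which exceeds the
     slack r / 2. *)
  have [yB gB _|yB _ hB] := boolP (y \in B); last first.
    exfalso; have := @sum_le_top R Y (rem y A) B (fun y => osc y f) r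
      (rem_uniq _ uA) uB.
    have onA' z : z \in B -> z \notin rem y A -> osc z f <= r.
      move=> zB; rewrite (rem_filter _ uA) mem_filter /= => zA; apply: onA.
      move: zA; apply: contra => ->; rewrite andbT.
      by apply: contraNneq yB => <-.
    have oA' z : z \in rem y A -> r <= osc z f by move=> /mem_rem/oA/ltW.
    move=> /(_ onA' oA').
    apply/negP; rewrite -ltNge.
    have : (size B)%:R * r <= (size A)%:R * r by rewrite ler_pM2r // ler_nat.
    have : \sum_(z <- rem y A) (osc z f - r) =
        \sum_(z <- A) osc z f - (size A)%:R * r - (osc y f - r).
      rewrite [in RHS](big_rem y) //= sumrB sum_const_seq.
      rewrite size_rem // -[X in _ = _ - X%:R * _ - _](prednK (_ : (0 < size A)%N)).
        by rewrite -natr1; ring.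
      by case: (A) yA.
    rewrite /r in hB *; lra.
  apply: le_lt_trans gB; rewrite /gap !mulr_suml -big_split -sumrB (big_rem y) //=.
  rewrite lerDl; apply: sumr_ge0 => z _.
  by have := gap_ge0 (good_cvx (hH z).1) cf cg; rewrite /gap.
have on_fibres f (e : R) (A : seq Y) : continuous f -> 0 < e ->
    (forall y, y \in A -> 0 < osc y f) ->
    exists2 d : R, 0 < d & forall g, continuous g -> gap G f g < d ->
      forall x, p x \in A -> `|f x - g x| <= e.
  move=> cf e0; elim: A => [|y A IH] oA; first by exists 1.
  have [|d d0 hd] := IH; first by move=> z zA; apply: oA; rewrite inE zA orbT.
  have [|d' d'0 hd'] := on_fibre f e y cf e0; first by apply: oA; rewrite inE eqxx.
  exists (Num.min d d'); first by rewrite lt_min d0.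
  move=> g cg; rewrite lt_min => /andP[h1 h2] x.
  by rewrite inE => /predU1P[|]; [exact: hd'|exact: hd].
move=> f e cf e0; have e4 : 0 < e / 4 by rewrite divr_gt0.
have [A [uA oA onA]] := large_osc_seq cf e4; set m := size A.
(* Over the [m] fibres of [A] the oscillations of [f] and [g] then differ by at most 2 m e1 <= e / 8
   in total. On any other fibre [g] oscillates by at most e/4 + e/8 + e/8 = e/2. *)
pose e1 := e / (16 * m.+1%:R).
have m0 : 0 < 16 * m.+1%:R :> R by rewrite mulr_gt0.
have e10 : 0 < e1 by rewrite divr_gt0.
have e1E : e1 * (16 * (m%:R + 1)) = e by rewrite natr1 divfK // gt_eqF.
have me1 : 0 <= m%:R * e1 by rewrite mulr_ge0 // ltW.
have {}e1E : 16 * (m%:R * e1) + 16 * e1 = e by rewrite -e1E; ring.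
have e1e : 16 * e1 <= e by rewrite -e1E lerDr mulr_ge0.
have [|d1 d10 hd1] := on_fibres f e1 A cf e10.
  by move=> y /oA; exact: lt_trans.
have [c [c0 hc]] := hG (m.+1, false).
pose d2 := c * (e / 16) ^+ 2.
have d20 : 0 < d2 by rewrite mulr_gt0 // exprn_gt0 // divr_gt0.
exists (Num.min d1 d2); first by rewrite lt_min d10.
move=> g cg; rewrite lt_min => /andP[/(hd1 g cg) hA h2] s t st.
have [psA|psA] := boolP (p s \in A).
  have ptA : p t \in A by rewrite -st.
  apply: le_trans (ler_normB _ _) _; have := hA _ psA; have := hA _ ptA; lra.
have hmax : osc_max m.+1 g <= osc_max m.+1 f + e / 8.
  have := gap_sqr (smax m.+1).2 cf cg.
  have : gap (fun f => osc_max m.+1 f ^+ 2) f g < (e / 16) ^+ 2.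
    by rewrite -(ltr_pM2l c0); apply: le_lt_trans h2; exact: hc.
  rewrite -[fun f => sup _ ^+ 2]/(fun f => osc_max m.+1 f ^+ 2).
  rewrite -!/(osc_max _ _); nra.
(* A family of size m + 1 has one place more than [A], worth at most e / 4; that place is given to
   the fibre of [s] in [maxg]. *)
have maxf : osc_max m.+1 f <= \sum_(y <- A) osc y f + e / 4.
  apply: ge_sup; first by exists (osc_sum (fam0 m.+1) f), (fam0 m.+1).
  move=> _ [[B PB] _ <-]; rewrite /osc_sum /=; have /andP[uB sB] := PB.
  have := @sum_le_top R Y A B (fun y => osc y f) (e / 4) uA uB.
  move=> /(_ (fun y _ => onA y) (fun y yA => ltW (oA y yA))).
  rewrite sumrB sum_const_seq -/m.
  have : (size B)%:R * (e / 4) <= m.+1%:R * (e / 4) by rewrite ler_pM2r // ler_nat.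
  by rewrite -natr1; lra.
have PA : uniq (p s :: A) && (size (p s :: A) <= m.+1)%N by rewrite /= psA uA leqnn.
have maxg : osc (p s) g + \sum_(y <- A) osc y g <= osc_max m.+1 g.
  apply: (sup_upper_bound ((smax m.+1).1 g cg)).
  by exists (exist _ (p s :: A) PA) => //; rewrite /osc_sum /= big_cons.
have sumA : \sum_(y <- A) osc y f <= \sum_(y <- A) osc y g + 2 * (m%:R * e1).
  rewrite (_ : 2 * (m%:R * e1) = \sum_(y <- A) (2 * e1)); last first.
    by rewrite sum_const_seq -/m; ring.
  rewrite -big_split /= big_seq [leRHS]big_seq; apply: ler_sum => y yA.
  apply: osc_le => // u v pu pv.
  rewrite (_ : f u - f v = (g u - g v) + ((f u - g u) - (f v - g v))); last by ring.
  apply: le_trans (ler_normD _ _) _; apply: lerD; first exact: le_osc.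
  apply: le_trans (ler_normB _ _) _.
  have := hA u; rewrite pu => /(_ yA); have := hA v; rewrite pv => /(_ yA); lra.
have og : osc (p s) g <= e / 2 by lra.
have := le_osc cf (erefl (p s)) (esym st); have := le_osc cg (erefl (p s)) (esym st).
have := onA _ psA => h3 h4 h5.
rewrite (_ : f s - g s - (f t - g t) = (f s - f t) - (g s - g t)); last by ring.
by apply: le_trans (ler_normB _ _) _; lra.
Qed.

End fibres.

(** * The base norm and the lifting *)

Section lifting.
Context {R : realType} {X Y : topologicalType} (p : X -> Y).
Hypotheses (hX : compact_hausdorff X) (hY : compact_hausdorff Y)
  (cp : continuous p) (sp : forall y, exists x, p x = y).
Implicit Types f g : X -> R.

(* [S f] is the least [c] such that [f \o s], for a fixed section [s] of [p],
   is a pointwise limit of functions of [C(Y)] of norm at most [c]. *)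
Lemma base_seminorm (N : (Y -> R) -> R) (b : R) : 0 < b ->
  is_norm_on_C setT N -> tau_p_lsc setT N ->
  (forall q, CA setT q -> N q <= b * supnorm setT q) ->
  exists2 S : (X -> R) -> R, lsc_seminorm b S &
    forall q, continuous q -> S (fun x => q (p x)) = N q.
Proof.
move=> b0 [_ N0 _ Nh Nt] lN bN; have [s hs] := choice sp; have cX := hX.2.
have toCA (q : Y -> R) : continuous q -> CA setT q by move/CA_continuous.
pose K f := [set c : R | 0 <= c /\ forall (F : seq Y) (d : R), 0 < d ->
  exists q, [/\ continuous q, N q <= c & forall y, y \in F -> `|q y - f (s y)| < d]].
have K0 f : lbound (K f) 0 by move=> c [].
have Kb f : continuous f -> K f (b * nrm f).
  move=> cf; have n0 := nrm_ge0 cX cf.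
  split=> [|F d d0]; first by rewrite mulr_ge0 // ltW.
  have [|q [cq qF qM]] := finite_interpolation (F := F) (u := f \o s) hY n0.
    by move=> y _; exact: (le_nrm cX).
  exists q; split => //; last by move=> y /qF ->; rewrite subrr normr0.
  apply: le_trans (bN _ (toCA _ cq)) _; rewrite ler_pM2l //.
  by apply: supnorm_le.
have iK f : continuous f -> has_inf (K f).
  by move=> cf; split; [exists (b * nrm f); exact: Kb|exists 0].
have K_up f c c' : K f c -> c <= c' -> K f c'.
  move=> [c0 h] cc'; split=> [|F d d0]; first exact: le_trans cc'.
  by have [q [h1 h2 h3]] := h F d d0; exists q; split => //; exact: le_trans cc'.
pose S f := inf (K f).
have S_le f c : continuous f -> K f c -> S f <= c.
  by move=> cf Kc; apply: ge_inf => //; exists 0.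
have S_lt f c : continuous f -> S f < c -> K f c.
  move=> cf Sc; have [c' Kc' /ltW cc'] := inf_lt (iK f cf).1 Sc.
  exact: K_up Kc' cc'.
have S0 f : continuous f -> 0 <= S f.
  by move=> cf; apply: lb_le_inf; [case: (iK f cf)|exact: K0].
have hom0 (a : R) f : continuous f -> S (fun x => a * f x) <= `|a| * S f.
  move=> cf; have caf := continuous_scale (a := a) cf.
  have Ka c : K f c -> K (fun x => a * f x) (`|a| * c).
    move=> [c0 h]; split=> [|F d d0]; first by rewrite mulr_ge0.
    have a1 : 0 < `|a| + 1 by rewrite ltr_wpDl.
    have [q [cq Nq qF]] := h F _ (divr_gt0 d0 a1).
    exists (fun y => a * q y); split.
    - exact: continuous_scale.
    - by rewrite Nh ?ler_wpM2l //; exact: toCA.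
    - move=> y /qF; rewrite -mulrBr normrM ltr_pdivlMr //.
      by have := normr_ge0 (q y - f (s y)); nra.
  have [a0|a0] := eqVneq `|a| 0.
    have [c Kc] := (iK f cf).1.
    by have := S_le _ _ caf (Ka c Kc); rewrite a0 !mul0r.
  have {}a0 : 0 < `|a| by rewrite lt_neqAle eq_sym a0 /=.
  rewrite mulrC -ler_pdivrMr //; apply: lb_le_inf; first by case: (iK f cf).
  by move=> c /Ka/(S_le _ _ caf); rewrite ler_pdivrMr // mulrC.
exists S; first split => //.
- move=> a f cf; apply/eqP; rewrite eq_le hom0 //=.
  have [->|a0] := eqVneq a 0.
    by rewrite normr0 mul0r S0 //; exact: continuous_scale.
  rewrite mulrC -ler_pdivlMr ?normr_gt0 //.
  have := hom0 a^-1 _ (continuous_scale (a := a) cf).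
  rewrite (_ : (fun x => _) = f); last by apply/funext => x; rewrite mulKf.
  by rewrite normfV mulrC.
- move=> f g cf cg; apply/ler_addgt0Pr => e e0.
  have e2 : 0 < e / 2 by rewrite divr_gt0.
  have [c0 hc] : K f (S f + e / 2) by apply: S_lt => //; rewrite ltrDl.
  have [c0' hc'] : K g (S g + e / 2) by apply: S_lt => //; rewrite ltrDl.
  rewrite (_ : S f + S g + e = (S f + e / 2) + (S g + e / 2)); last by field.
  apply: S_le; first exact: continuous_add.
  split=> [|F d d0]; first exact: addr_ge0.
  have d2 : 0 < d / 2 by rewrite divr_gt0.
  have [q [cq Nq qF]] := hc F _ d2; have [r [cr Nr rF]] := hc' F _ d2.
  exists (fun y => q y + r y); split; first exact: continuous_add.
    by apply: le_trans (Nt _ _ (toCA _ cq) (toCA _ cr)) _; exact: lerD.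
  move=> y yF; have := qF y yF; have := rF y yF.
  rewrite (_ : q y + r y - (f (s y) + g (s y)) =
    (q y - f (s y)) + (r y - g (s y))); last by ring.
  by have := ler_normD (q y - f (s y)) (r y - g (s y)); lra.
- by move=> f cf; apply: S_le => //; exact: Kb.
- move=> f cf e e0.
  have [Se|eS] := ltP (S f) e.
    by exists [::], 1; split => // g cg _; have := S0 g cg; lra.
  (* Below the infimum, some finite set and radius obstruct all approximants of norm at most [c].
     Halving the radius keeps the obstruction for every [g] close to [f] on that set. *)
  set c := S f - e / 2.
  have nK : ~ K f c by move=> /(S_le f c cf); rewrite leNgt /c => /negP; apply; lra.
  have [F [d [d0 hF]]] : exists (F : seq Y) (d : R), 0 < d /\
      ~ exists q, [/\ continuous q, N q <= c &
        forall y, y \in F -> `|q y - f (s y)| < d].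
    apply: contrapT => H; apply: nK; split=> [|F d d0]; first by rewrite /c; lra.
    by apply: contrapT => H'; apply: H; exists F, d.
  exists [seq s y | y <- F], (d / 2); split; first by rewrite divr_gt0.
  move=> g cg hg; suff : c <= S g by rewrite /c; lra.
  rewrite leNgt; apply/negP => /(S_lt g c cg)[_ /(_ F (d / 2))].
  rewrite divr_gt0 // => /(_ isT)[q [cq Nq qF]].
  apply: hF; exists q; split => // y yF.
  have := hg _ (map_f s yF); have := qF y yF.
  have := ler_normD (q y - g (s y)) (g (s y) - f (s y)).
  by rewrite subrKA; lra.
move=> q cq; have cqp : continuous (fun x => q (p x)).
  by move=> x; apply: continuous_comp; [exact: cp|exact: cq].
apply/eqP; rewrite eq_le; apply/andP; split.
  apply: S_le => //; split=> [|F d d0]; first by apply: N0; exact: toCA.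
  by exists q; split => // y _; rewrite hs subrr normr0.
(* Here pointwise lower semicontinuity of [N] enters: an approximant close to [q] on a suitable
   finite set has norm above N q - e. *)
apply: lb_le_inf; first by case: (iK _ cqp).
move=> c [_ hc]; apply/ler_addgt0Pr => e e0.
have [F [d [_ d0 hF]]] := lN q (toCA _ cq) e e0.
have [r [cr Nr rF]] := hc F d d0.
have : N q - e < N r.
  by apply: hF => [|y yF]; [exact: toCA|have := rF y yF; rewrite hs].
lra.
Qed.

(** [mu] takes the least element for a well order. If each of two least elements lies in the other
    set, each precedes the other. *)
Lemma well_ordered_choice (T : eqType) (t0 : T) : exists mu : set T -> T,
  (forall A, A !=set0 -> A (mu A)) /\
  (forall A B, A !=set0 -> B !=set0 -> A (mu B) -> B (mu A) -> mu A = mu B).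
Proof.
have [r wo] := wochoice.well_ordering_principle T.
have /choice[mu hmu] : forall A : set T, exists z : T, A !=set0 ->
    A z /\ forall x, A x -> r z x.
  move=> A; have [[x Ax]|A0] := pselect (A !=set0); last by exists t0.
  have [|z [[/asboolP Az hz] _]] := wo (fun x => `[<A x>]).
    by exists x; apply/asboolP.
  by exists z => _; split => // y Ay; apply: hz; apply/asboolP.
exists mu; split=> [A|A B nA nB AB BA]; first by move=> /hmu[].
have rAB := (hmu A nA).2 _ AB; have rBA := (hmu B nB).2 _ BA.
have rr z : r z z.
  have [|w [[/eqP -> hw] _]] := wo (fun x => x == z); first by exists z; exact: eqxx.
  by apply: hw; exact: eqxx.
(* Antisymmetry is obtained from the uniqueness of the least element of the pair. *)
have [|w [_ uw]] := wo (fun x => (x == mu A) || (x == mu B)).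
  by exists (mu A); rewrite /in_mem /= eqxx.
transitivity w; [apply/esym|]; apply: uw; split.
- by rewrite /in_mem /= eqxx.
- by move=> x /orP[] /eqP ->.
- by rewrite /in_mem /= eqxx orbT.
- by move=> x /orP[] /eqP ->.
Qed.

Lemma expr_half_lt (e : R) : 0 < e -> exists n, 2^-1 ^+ n < e.
Proof.
move=> e0; have h : `|2^-1 : R| < 1 by rewrite ger0_norm // invf_lt1 // ltr1n.
have /cvgrPdist_lt/(_ e e0)[n _ hn] := cvg_expr h.
by exists n; have := hn n (leqnn n); rewrite /= sub0r normrN ger0_norm.
Qed.

Lemma geometric_limit (u : nat -> X -> R) : (forall n, continuous (u n)) ->
  (forall n x, `|u n.+1 x - u n x| <= 4 * 2^-1 ^+ n) ->
  exists2 U : X -> R, continuous U & forall n x, `|u n x - U x| <= 8 * 2^-1 ^+ n.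
Proof.
move=> cu hu.
(* The steps from [n] on add up to at most 8 * 2^-n, so the intervals from [lo n] to [hi n] are
   nested. *)
pose lo n x := u n x - 8 * 2^-1 ^+ n; pose hi n x := u n x + 8 * 2^-1 ^+ n.
have step n x : lo n x <= lo n.+1 x /\ hi n.+1 x <= hi n x.
  by have := hu n x; rewrite /lo /hi exprS ler_norml => /andP[]; split; lra.
have lo_mono m n x : (m <= n)%N -> lo m x <= lo n x.
  move=> /subnK <-; elim: (n - m)%N => // d IH.
  by apply: le_trans IH _; rewrite addSn; exact: (step _ x).1.
have hi_mono m n x : (m <= n)%N -> hi n x <= hi m x.
  move=> /subnK <-; elim: (n - m)%N => // d IH.
  by apply: le_trans IH; rewrite addSn; exact: (step _ x).2.
have lohi m n x : lo m x <= hi n x.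
  apply: le_trans (lo_mono m (maxn m n) x (leq_maxl _ _)) _.
  apply: le_trans (hi_mono n (maxn m n) x (leq_maxr _ _)).
  by rewrite /lo /hi; have : 0 <= 2^-1 ^+ maxn m n :> R by []; lra.
pose U x := sup (range (lo^~ x)).
have hs x : has_sup (range (lo^~ x)).
  by split; [exists (lo 0%N x), 0%N|exists (hi 0%N x) => _ [n _ <-]].
have hU n x : `|u n x - U x| <= 8 * 2^-1 ^+ n.
  have h1 : lo n x <= U x by apply: (sup_upper_bound (hs x)); exists n.
  have h2 : U x <= hi n x by apply: ge_sup; [case: (hs x)|move=> _ [m _ <-]].
  by move: h1 h2; rewrite ler_norml /lo /hi; lra.
exists U => // x; apply/cvgrPdist_lt => e e0.
have [n hn] := expr_half_lt (divr_gt0 e0 (ltr0n R 24)).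
have e3 : 0 < e / 3 by rewrite divr_gt0.
have /cvgrPdist_lt/(_ _ e3) hx := cu n x; apply: filterS hx => z hz.
have := hU n x; have := hU n z; move: hz.
rewrite (_ : U x - U z = - (u n x - U x) + (u n x - u n z) + (u n z - U z)); last by ring.
move=> h1 h2 h3; have := ler_normD (- (u n x - U x) + (u n x - u n z)) (u n z - U z).
have := ler_normD (- (u n x - U x)) (u n x - u n z); rewrite normrN.
lra.
Qed.

(** A small class modulo C(Y) has a small representative: subtract the function of [fosc_approx], at
    the cost of a factor 2. *)
Lemma lifting_step (n : nat) f : continuous f -> fosc p f (2 * 2^-1 ^+ n) ->
  exists U, [/\ continuous U, (forall x, `|U x| <= 4 * 2^-1 ^+ n) &
    fosc p (fun x => f x - U x) 0].
Proof.
move=> cf fn; have r0 : 0 < 2 * 2^-1 ^+ n :> R by rewrite mulr_gt0 // exprn_gt0.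
have [q cq qf] := fosc_approx hX hY cp sp cf r0 fn.
exists (fun x => f x - q (p x)); split.
- apply: continuous_sub => // x.
  by apply: continuous_comp; [exact: cp|exact: cq].
- by move=> x; apply: le_trans (qf x) _; rewrite mulrA -natrM.
- by move=> s t st /=; rewrite !subKr st subrr normr0.
Qed.

(* A substitute for a Bartle-Graves selector of [C(X) -> C(X) / C(Y)]: [B n]
   is constant on the pieces [E n k] at the scale [1 / (k + 1)], and the [B n f]
   converge to some [U] in the class of [f]. Choosing, for the quantisation of
   a class at scale [2^-n], the least admissible centre in a well order makes
   it locally constant on each piece. *)
Lemma lifting_sequence : exists (B : nat -> (X -> R) -> X -> R)
    (E : nat -> nat -> set (X -> R)),
  [/\ forall n f, continuous f -> continuous (B n f),
      forall f, continuous f -> exists U, [/\ continuous U,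
        fosc p (fun x => f x - U x) 0 &
        forall n x, `|B n f x - U x| <= 8 * 2^-1 ^+ n],
      forall n f, continuous f -> exists k0, forall k, (k0 <= k)%N -> E n k f &
      forall n k f g, continuous f -> continuous g -> E n k f -> E n k g ->
        fosc p (fun x => f x - g x) k.+1%:R^-1 -> B n f = B n g].
Proof.
have [mu [mu1 mu2]] := @well_ordered_choice (X -> R) (fun=> 0).
(* The strict inequality leaves room between [r] and 2^-n, which puts [f] in [E n k] for all large
   [k]. *)
pose near_f n f := [set g | continuous g /\
  exists2 r : R, r < 2^-1 ^+ n & fosc p (fun x => f x - g x) r].
pose v n f := mu (near_f n f).
have near0 n f : continuous f -> near_f n f !=set0.
  move=> cf; exists f; split => //; exists 0; first by rewrite exprn_gt0.
  by move=> s t _; rewrite !subrr normr0.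
have vP n f : continuous f -> near_f n f (v n f) by move=> /near0/mu1.
have cv n f : continuous f -> continuous (v n f) by move=> /(vP n)[].
have ov n f : continuous f -> fosc p (fun x => f x - v n f x) (2^-1 ^+ n).
  by move=> /(vP n)[_ [r /ltW rn]]; exact: fosc_le.
(* The lift is chosen as a function of the increment alone, so equal centres give equal lifts. *)
have /choice[L hL] : forall nw : nat * (X -> R), exists U,
    continuous nw.2 -> fosc p nw.2 (2 * 2^-1 ^+ nw.1) ->
    [/\ continuous U, (forall x, `|U x| <= 4 * 2^-1 ^+ nw.1) &
    fosc p (fun x => nw.2 x - U x) 0].
  move=> [n w] /=; have [cw|?] := pselect (continuous w); last by exists w.
  have [ow|?] := pselect (fosc p w (2 * 2^-1 ^+ n)); last by exists w.
  by have [U hU] := lifting_step cw ow; exists U.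
pose inc n f x := v n.+1 f x - v n f x.
have inc_osc n f : continuous f -> fosc p (inc n f) (2 * 2^-1 ^+ n).
  move=> cf; have h := fosc_sub (ov n f cf) (ov n.+1 f cf).
  rewrite (_ : inc n f = fun x => f x - v n f x - (f x - v n.+1 f x)).
    have q0 : 0 < 2^-1 ^+ n :> R by rewrite exprn_gt0.
    by apply: fosc_le h; rewrite exprS; lra.
  by apply/funext => x; rewrite /inc; ring.
have cinc n f : continuous f -> continuous (inc n f).
  by move=> cf; apply: continuous_sub; exact: cv.
pose B := fix B n f := if n is m.+1 then fun x => B m f x + L (m, inc m f) x
                       else v 0%N f.
have cB n f : continuous f -> continuous (B n f).
  move=> cf; elim: n => [|n IH]; first exact: cv.
  apply: continuous_add => //.
  by have [] := hL (n, inc n f) (cinc n f cf) (inc_osc n f cf).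
have vB n f : continuous f -> fosc p (fun x => v n f x - B n f x) 0.
  move=> cf; elim: n => [|n IH]; first by move=> s t _ /=; rewrite !subrr normr0.
  have [_ _ h] := hL (n, inc n f) (cinc n f cf) (inc_osc n f cf).
  have := fosc_add IH h; rewrite addr0; congr fosc.
  by apply/funext => x; rewrite /inc /=; ring.
(* With slack 2 / (k + 1), moving by 1 / (k + 1) still leaves slack: the centre of [g] is admissible
   for [f] and conversely, so the two least centres coincide. *)
pose E n k := [set f | forall m, (m <= n)%N ->
  fosc p (fun x => f x - v m f x) (2^-1 ^+ m - 2 / k.+1%:R)].
exists B, E; split => //.
- move=> f cf; have [n x|n x|U cU hU] := @geometric_limit (fun n => B n f).
  + exact: cB.
  + have [_ h _] := hL (n, inc n f) (cinc n f cf) (inc_osc n f cf).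
    by rewrite /= addrC addKr.
  exists U; split => // s t st; apply/ler_addgt0Pr => e e0; rewrite add0r.
  (* 17 = 1 + 0 + 2 * 8: the distance of [f] to its centre, of the centre to [B n f], and twice the
     sup distance of [B n f] to [U]. *)
  have [n hn] := expr_half_lt (divr_gt0 e0 (ltr0n R 17)).
  have h1 := fosc_add (fosc_add (ov n f cf) (vB n f cf))
    (@fosc_bound _ _ _ p (fun x => B n f x - U x) _ (hU n)).
  have := h1 s t st; rewrite /= !(addrA, subrK) => h2; apply: le_trans h2 _.
  by move: hn; lra.
- move=> n f cf.
  have /choice[K hK] : forall m : nat, exists k0, forall k, (k0 <= k)%N ->
      fosc p (fun x => f x - v m f x) (2^-1 ^+ m - 2 / k.+1%:R).
    move=> m; have [_ [r rm fr]] := vP m f cf.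
    have d0 : 0 < 2^-1 ^+ m - r by rewrite subr_gt0.
    exists (Num.truncn (2 / (2^-1 ^+ m - r))) => k kk; apply: fosc_le fr.
    suff : 2 / k.+1%:R <= 2^-1 ^+ m - r by move: (_ / _) => q; lra.
    rewrite ler_pdivrMr // mulrC -ler_pdivrMr //.
    by apply: le_trans (ltW (truncnS_gt _)) _; rewrite ler_nat.
  exists (\max_(m < n.+1) K m) => k hk m mn; apply: hK.
  exact: leq_trans (leq_bigmax (Ordinal (mn : (m < n.+1)%N))) hk.
- move=> n k f g cf cg Ef Eg fg.
  have vE m : (m <= n)%N -> v m f = v m g.
    have k0 : 0 < k.+1%:R^-1 :> R by rewrite invr_gt0.
    have key f' g' : continuous g' -> E n k g' ->
        fosc p (fun x => f' x - g' x) k.+1%:R^-1 -> (m <= n)%N ->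
        near_f m f' (v m g').
      move=> cg' Eg' fg' mn; split; first exact: cv.
      exists (2^-1 ^+ m - k.+1%:R^-1); first by rewrite ltrBlDr ltrDl.
      have := fosc_add fg' (Eg' m mn).
      rewrite (_ : (fun x => _) = fun x => f' x - v m g' x).
        by apply: fosc_le; move: k.+1%:R^-1 => q; lra.
      by apply/funext => x; ring.
    move=> mn; apply: mu2; [exact: near0|exact: near0|exact: key|].
    apply: key => // s t st; have := fg s t st; rewrite -normrN.
    by congr (`|_| <= _); ring.
  elim: n vE {Ef Eg} => [|n IH] vE; first exact: vE.
  have vE' m : (m <= n)%N -> v m f = v m g by move=> mn; apply: vE; exact: leqW.
  by rewrite /= IH // /inc !vE.
Qed.

End lifting.

(** * The three-space step *)

Section seminorm_estimates.
Context {R : realType} {X : topologicalType}.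
Hypothesis cX : compact [set: X].
Implicit Types (u v : X -> R) (S : (X -> R) -> R).

Lemma sn_lipschitz (C r : R) S u v : 0 <= C -> lsc_seminorm C S -> continuous u ->
  continuous v -> (forall x, `|u x - v x| <= r) -> 0 <= r -> S u <= S v + C * r.
Proof.
move=> C0 sS cu cv uv r0; have cuv := continuous_sub cu cv.
have := sn_tri sS cv cuv; rewrite (_ : (fun x => _) = u); last first.
  by apply/funext => x; ring.
move=> h; apply: le_trans h _; rewrite lerD2l.
by apply: le_trans (sn_bnd sS cuv) _; rewrite ler_wpM2l //; apply: nrm_le.
Qed.

(** Each squared value moves by at most 2 C r Q; the weights 1/2, 1/2 and 1 in the gap add up to
    2. *)
Lemma gap_sqr_close (C r Q : R) S u v u' v' : 0 <= C -> 0 <= r -> lsc_seminorm C S ->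
  continuous u -> continuous v -> continuous u' -> continuous v' ->
  (forall x, `|u x - u' x| <= r) -> (forall x, `|v x - v' x| <= r) ->
  S u <= Q -> S v <= Q -> S u' <= Q -> S v' <= Q ->
  gap (fun f => S f ^+ 2) u' v' <= gap (fun f => S f ^+ 2) u v + 4 * (C * r * Q).
Proof.
move=> C0 r0 sS cu cv cu' cv' uu vv uQ vQ u'Q v'Q.
have S0 := sn_ge0 sS.
have mle f g : continuous f -> continuous g -> S f <= Q -> S g <= Q ->
    S (mid f g) <= Q.
  move=> cf cg fQ gQ; rewrite (_ : mid f g = fun x => 2^-1 * (f x + g x)).
    rewrite (sn_hom sS) ?ger0_norm //; last exact: continuous_add.
    by have := sn_tri sS cf cg; lra.
  by apply/funext => x; rewrite /mid mulrC.
have sq (a b : R) : 0 <= a -> 0 <= b -> a <= Q -> b <= Q -> a <= b + C * r ->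
    a ^+ 2 <= b ^+ 2 + 2 * (C * r * Q).
  move=> a0 b0 aQ bQ ab; have [h|h] := leP a b.
    have : 0 <= C * r * Q by rewrite !mulr_ge0 //; lra.
    by nra.
  have : (a - b) * (a + b) <= C * r * (Q + Q) by apply: ler_pM; lra.
  by nra.
have cm := continuous_mid cu cv; have cm' := continuous_mid cu' cv'.
have hm x : `|mid u v x - mid u' v' x| <= r.
  have := uu x; have := vv x; rewrite /mid !ler_norml.
  by move=> /andP[? ?] /andP[? ?]; apply/andP; split; lra.
have uu' x : `|u' x - u x| <= r by rewrite distrC.
have vv' x : `|v' x - v x| <= r by rewrite distrC.
have h1 := sq _ _ (S0 _ cu') (S0 _ cu) u'Q uQ (sn_lipschitz C0 sS cu' cu uu' r0).
have h2 := sq _ _ (S0 _ cv') (S0 _ cv) v'Q vQ (sn_lipschitz C0 sS cv' cv vv' r0).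
have h3 := sq _ _ (S0 _ cm) (S0 _ cm') (mle _ _ cu cv uQ vQ) (mle _ _ cu' cv' u'Q v'Q)
  (sn_lipschitz C0 sS cm cm' hm r0).
by rewrite /gap; lra.
Qed.

End seminorm_estimates.

(** Pointwise estimates for the final step, with [u] a value of [U], [v] of its approximation, and
    [q] of an element of C(Y) close to g - U. *)
Lemma perturbation_bounds {R : realDomainType} (f g u v q r F W : R) :
  r <= 1 -> `|v - u| <= r -> `|g - u - q| <= 2 * r ->
  `|f| <= F -> `|g| <= F + 1 -> `|u| <= W ->
  [/\ `|f - v - (f - u)| <= 3 * r, `|g - v - q| <= 3 * r &
    [/\ `|f - v| <= F + W + 4, `|g - v| <= F + W + 4,
      `|f - u| <= F + W + 4 & `|q| <= F + W + 4]].
Proof.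
move=> r1; rewrite !ler_norml.
move=> /andP[? ?] /andP[? ?] /andP[? ?] /andP[? ?] /andP[? ?].
by split; [| |split]; apply/andP; split; lra.
Qed.

Section main.
Context {R : realType} {X Y : topologicalType} (p : X -> Y).
Hypotheses (hX : compact_hausdorff X) (hY : compact_hausdorff Y)
  (cp : continuous p) (sp : forall y, exists x, p x = y).
Implicit Types f g : X -> R.

(* [2 * G ((f + a) / 2) - G a = G f - 2 * gap G f a]: its supremum over [a] is
   attained at [a = f], and its near-maximisers have a small gap to [f]. *)
Lemma piece_functional (G S : (X -> R) -> R) (b K : R)
    (B : (X -> R) -> X -> R) (P : set (X -> R)) :
  0 <= b -> 0 <= K -> good 1 G -> lsc_seminorm b S -> (forall a, P a -> continuous a) ->
  (forall a, P a -> continuous (B a) /\ nrm (B a) <= K) ->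
  exists2 H, good 1 H & forall f (c e : R), P f -> 0 < c -> 0 < e ->
    exists2 d : R, 0 < d & forall g, continuous g -> gap H f g < d ->
      exists a, [/\ P a, gap G f a <= c &
        gap (fun h => S h ^+ 2) (fun x => f x - B a x) (fun x => g x - B a x) < e].
Proof.
move=> b0 K0 gG sS cP BP; have cX := hX.2.
have [[a0 Pa0]|P0] := pselect (P !=set0); last first.
  exists (fun=> 0); first by apply: good_weaken (good_cst cX 0); rewrite normr0.
  by move=> f c e Pf; exfalso; apply: P0; exists f.
pose I := {a : X -> R | P a}.
pose phi (a : I) f := 2 * G (mid f (sval a)) - G (sval a).
pose psi (a : I) f := S (fun x => 1 * f x + -1 * B (sval a) x) ^+ 2.
have gphi (a : I) : good (2 * (1 * (1 + nrm (fun x => 2^-1 * sval a x)) ^+ 2)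
    + `|- G (sval a)|) (phi a).
  have h2 : `|2^-1 : R| <= 1 by rewrite ger0_norm // invf_le1 // ler1n.
  have ca := @continuous_scale _ _ (sval a) 2^-1 (cP _ (svalP a)).
  have := good_add (good_scale (ler0n R 2) (good_comp cX ca h2 gG))
    (good_cst cX (- G (sval a))).
  congr good; apply/funext => f; rewrite /phi; congr (2 * G _ - _).
  by apply/funext => x; rewrite /mid; field.
have gpsi (a : I) : good (b ^+ 2 * (1 + K) ^+ 2) (psi a).
  have [cB BK] := BP _ (svalP a).
  have cB' := @continuous_scale _ _ (B (sval a)) (-1) cB.
  have h1 : `|1 : R| <= 1 by rewrite normr1.
  apply: good_weaken (good_comp cX cB' h1 (sn_sqr cX b0 sS)).
  apply: ler_wpM2l; first exact: sqr_ge0.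
  have n0 := nrm_ge0 cX cB'; rewrite ler_sqr ?nnegrE ?addr_ge0 // lerD2l.
  apply: nrm_le => // x; rewrite mulN1r normrN; apply: le_trans BK; exact: le_nrm.
have phiE (a : I) f : phi a f = G f - 2 * gap G f (sval a).
  by rewrite /phi /gap; field.
pose i0 : I := exist _ a0 Pa0.
pose D := 2 * (1 * (1 + nrm (fun x => 2^-1 * a0 x)) ^+ 2) + `|- G a0|.
pose C := `|D| + b ^+ 2 * (1 + K) ^+ 2 + 1.
have KK : 0 <= b ^+ 2 * (1 + K) ^+ 2 by rewrite mulr_ge0 ?sqr_ge0.
have C0 : 0 < C by rewrite /C; have := normr_ge0 D; lra.
have [| | |H gH hH] := good_master cX (i0 := i0) C0 (fun a => good_cvx (gphi a))
    (fun a => good_lsc (gphi a)) _ _ (psi := psi).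
(* The constants in [gphi] depend on [a]; the uniform upper bound comes from phi <= G, as gaps are
   nonnegative. *)
- move=> a f cf; rewrite phiE; have ca := cP _ (svalP a).
  have := gap_ge0 (good_cvx gG) cf ca; have := good_bnd gG cf.
  have := ler_norm (G f) => h1 h2 h3.
  have : 1 * (1 + nrm f) ^+ 2 <= C * (1 + nrm f) ^+ 2.
    by apply: ler_wpM2r; [exact: sqr_ge0|rewrite /C; have := normr_ge0 D; lra].
  by lra.
- move=> f cf; have := good_bnd (gphi i0) cf; rewrite ler_norml => /andP[h _].
  apply: le_trans h; rewrite lerN2; apply: ler_wpM2r; first exact: sqr_ge0.
  by rewrite -/D /C; have := ler_norm D; lra.
- move=> a; apply: good_weaken (gpsi a).
  by rewrite /C; have := normr_ge0 D; lra.
exists H => // f c e Pf c0 e0; have cf := cP _ Pf.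
have [d d0 hd] := hH f c e cf c0 e0; exists d => // g cg hg.
have [a ha ga] := hd g cg hg; exists (sval a); split; first exact: svalP.
  (* Compare with the index [f] itself, where the gap vanishes. *)
  have := ha (exist _ f Pf); rewrite !phiE /= {1}/gap.
  rewrite (_ : mid f f = f); last by apply/funext => x; rewrite /mid; field.
  by have := gap_ge0 (good_cvx gG) cf (cP _ (svalP a)); lra.
move: ga; rewrite /psi /gap /=.
have E h : (fun x => 1 * h x + -1 * B (sval a) x) = fun x => h x - B (sval a) x.
  by apply/funext => x; ring.
rewrite !E; congr (_ - S _ ^+ 2 < _).
by apply/funext => x; rewrite /mid; field.
Qed.

Lemma fully_closed_LUR (x0 : X) : fully_closed p ->
  has_LUR_lsc_norm R [set: Y] ->
  (forall y, has_LUR_lsc_norm R (p @^-1` [set y])) ->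
  has_LUR_lsc_norm R [set: X].
Proof.
move=> fp [N [nN [a [b [a0 b0 ab]]] LN lN]] hfib; have [cX cY] := (hX.2, hY.2).
have [G1 gG1 hG1] := osc_functional hX hY cp sp fp hfib.
have [S sS SN] := base_seminorm hX hY cp sp b0 nN lN (fun q cq => (ab q cq).2).
have [B [E [cB BU BE Bloc]]] := lifting_sequence hX hY cp sp (R := R).
(* The second index serves both as the scale of local constancy and as the bound on the
   approximations required by [piece_functional]. *)
pose P (i : nat * nat) := [set f : X -> R |
  [/\ continuous f, nrm (B i.1 f) <= i.2%:R & E i.1 i.2 f]].
have /choice[H hH] : forall i : nat * nat, exists H, good 1 H /\
    forall f (c e : R), P i f -> 0 < c -> 0 < e ->
    exists2 d : R, 0 < d & forall g, continuous g -> gap H f g < d ->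
      exists a, [/\ P i a, gap G1 f a <= c &
        gap (fun h => S h ^+ 2) (fun x => f x - B i.1 a x)
          (fun x => g x - B i.1 a x) < e].
  move=> i; have [||H gH hH] := @piece_functional G1 S b i.2%:R (B i.1) (P i)
    (ltW b0) (ler0n R _) gG1 sS.
  - by move=> f [].
  - by move=> f [cf ? _]; split => //; exact: cB.
  by exists H.
have snrm := sn_nrm cX x0 (R := R).
have gnrm : good 1 (fun f : X -> R => nrm f ^+ 2).
  by have := sn_sqr cX ler01 snrm; rewrite expr1n.
have [|G [gG G0 Gs G00 hG]] := good_sum_countable cX
    (H := fun i : (nat * nat) + bool =>
      match i with inl i => H i | inr true => G1 | inr false => fun f => nrm f ^+ 2 end).
  by move=> [i|[]]; exists 1 => //; exact: (hH i).1.
have nrm0 : nrm (fun _ : X => 0 : R) = 0.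
  apply/eqP; rewrite eq_le nrm_ge0 // andbT.
  by apply: nrm_le => // x; rewrite normr0.
apply: (gauge_LUR_lsc cX (Psi := fun f => G f + nrm f ^+ 2) (C := 1 + 1)).
- by rewrite lerDl.
- exact: good_add.
- move=> f; rewrite Gs; congr (_ + _ ^+ 2); rewrite /nrm /supnorm.
  by congr sup; congr image; apply/funext => x; rewrite normrN.
- by rewrite G00 nrm0 expr0n /= addr0.
- by move=> f cf; rewrite lerDr G0.
move=> f e cf e0.
have [U [cU fU BfU]] := BU f cf.
have [q0 cq0 q0E] := fosc0_factor hX hY cp sp (continuous_sub cf cU) fU.
have toCA (q : Y -> R) : continuous q -> CA setT q by move/CA_continuous.
have [dN dN0 hdN] := LUR_gap_sqr nN LN (toCA _ cq0)
  (mulr_gt0 a0 (divr_gt0 e0 (ltr0n R 2))).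
have f0 := nrm_ge0 cX cf; have U0 := nrm_ge0 cX cU.
pose Q := b * (nrm f + nrm U + 4).
have Q0 : 0 < Q by rewrite mulr_gt0 //; lra.
have bQ : 0 < 24 * (b * Q) by rewrite mulr_gt0 // mulr_gt0.
(* The bound e / 4 pays for the error 2 r <= e / 2 at the end. The last bound makes the cost 4 * b *
   (3 r) * Q of [gap_sqr_close] at most dN / 2, on top of the dN / 4 asked for below. *)
pose r := Num.min 1 (Num.min (e / 4) (dN / (24 * (b * Q)))).
have r0 : 0 < r by rewrite !lt_min ltr01 !divr_gt0.
have r1 : r <= 1 by rewrite ge_min lexx.
have re : r <= e / 4 by rewrite !ge_min lexx orbT.
have rQ : r * (24 * (b * Q)) <= dN.
  by rewrite -ler_pdivlMr // !ge_min lexx !orbT.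
have [n hn] := expr_half_lt (divr_gt0 r0 (ltr0n R 8)).
have BfU' x : `|B n f x - U x| <= r by apply: le_trans (BfU n x) _; lra.
have [k0 hk0] := BE n f cf.
pose k := maxn k0 (Num.truncn (nrm (B n f))).+1.
have Pf : P (n, k) f.
  split => //=; last by apply: hk0; exact: leq_maxl.
  by apply: le_trans (ltW (truncnS_gt _)) _; rewrite ler_nat leq_maxr.
have k1 : 0 < k.+1%:R^-1 :> R by rewrite invr_gt0.
have [da da0 hda] := hG1 f _ cf k1.
have [d1 d10 hd1] := (hH (n, k)).2 f (da / 2) (dN / 4) Pf
  (divr_gt0 da0 (ltr0n R 2)) (divr_gt0 dN0 (ltr0n R 4)).
have [d2 d20 hd2] := hG1 f r cf r0.
have [c1 [c10 hc1]] := hG (inl (n, k)).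
have [c2 [c20 hc2]] := hG (inr true).
have [c3 [c30 hc3]] := hG (inr false).
exists (Num.min (c1 * d1) (Num.min (c2 * d2) (c3 / 4))).
  by rewrite !lt_min !mulr_gt0.
move=> g cg; rewrite !lt_min => /and3P[l1 l2 l3] x.
have gapG : gap G f g <= gap (fun f => G f + nrm f ^+ 2) f g.
  by have := gap_ge0 (good_cvx gnrm) cf cg; rewrite /gap; lra.
have m1 : gap (H (n, k)) f g < d1.
  by rewrite -(ltr_pM2l c10); apply: le_lt_trans l1; apply: le_trans gapG; exact: hc1.
have m2 : gap G1 f g < d2.
  by rewrite -(ltr_pM2l c20); apply: le_lt_trans l2; apply: le_trans gapG; exact: hc2.
have m3 : gap (fun f => nrm f ^+ 2) f g < 1 / 4.
  rewrite -(ltr_pM2l c30) mulrA mulr1; apply: le_lt_trans l3.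
  by apply: le_trans gapG; exact: hc3.
have ng : nrm g <= nrm f + 1.
  by have := gap_sqr snrm cf cg; nra.
have [h [Ph fh gh]] := hd1 g cg m1.
(* The selected [h] lies in the piece of [f] and is close to it modulo C(Y), at the scale fixed by
   [k]; local constancy replaces the approximation of [h] by that of [f]. *)
have BhE : B n h = B n f.
  apply/esym/(Bloc n k) => //; [by case: Ph|by case: Pf|by case: Ph|].
  by apply: hda; [case: Ph|apply: le_lt_trans fh _; rewrite ltr_pdivrMr // ltr_pMr // ltr1n].
rewrite /= BhE in gh.
have ogU : fosc p (fun x => g x - U x) r.
  have := fosc_sub fU (hd2 g cg m2); rewrite add0r; congr fosc.
  by apply/funext => y; ring.
have [q cq qE] := fosc_approx hX hY cp sp (continuous_sub cg cU) r0 ogU.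
have cqp (u : Y -> R) : continuous u -> continuous (fun x => u (p x)).
  by move=> cu y; apply: continuous_comp; [exact: cp|exact: cu].
have cBf := cB n f cf.
have Sb u : continuous u -> (forall y, `|u y| <= nrm f + nrm U + 4) -> S u <= Q.
  move=> cu hu; apply: le_trans (sn_bnd sS cu) _; rewrite ler_pM2l //.
  by apply: nrm_le => //; rewrite !addr_ge0.
have bnd y : [/\ `|f y| <= nrm f, `|g y| <= nrm f + 1 & `|U y| <= nrm U].
  by split; [exact: le_nrm|apply: le_trans ng; exact: le_nrm|exact: le_nrm].
(* Subtracting [B n f] puts [f] and [g] within 3 r of elements of C(Y), where [S] is the norm
   [N]. *)
have gN : gap (fun u => N u ^+ 2) q0 q < dN.
  have r3 : 0 <= 3 * r by rewrite mulr_ge0 // ltW.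
  have := @gap_sqr_close R X b (3 * r) Q S (fun x => f x - B n f x)
    (fun x => g x - B n f x) (fun x => q0 (p x)) (fun x => q (p x)) (ltW b0) r3 sS
    (continuous_sub cf cBf) (continuous_sub cg cBf) (cqp _ cq0) (cqp _ cq).
  have -> : gap (fun f => S f ^+ 2) (fun x => q0 (p x)) (fun x => q (p x)) =
      gap (fun u => N u ^+ 2) q0 q.
    rewrite /gap !SN //; congr (_ - _ ^+ 2).
    by rewrite -(SN (mid q0 q)) //; exact: continuous_mid.
  have pb y := let: And3 fy gy uy := bnd y in
    perturbation_bounds r1 (BfU' y) (qE y) fy gy uy.
  move=> close; apply: le_lt_trans (close _ _ _ _ _ _) _.
  - by move=> y; rewrite -q0E; have [] := pb y.
  - by move=> y; have [] := pb y.
  - by apply: Sb => [|y]; [exact: continuous_sub|have [_ _ []] := pb y].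
  - by apply: Sb => [|y]; [exact: continuous_sub|have [_ _ []] := pb y].
  - by apply: Sb => [|y]; [exact: cqp|rewrite -q0E; have [_ _ []] := pb y].
  - by apply: Sb => [|y]; [exact: cqp|have [_ _ []] := pb y].
  have : 4 * (b * (3 * r) * Q) = r * (24 * (b * Q)) / 2 by field.
  by lra.
have := hdN q (toCA _ cq) gN => Nq.
have cd := continuous_sub cq0 cq.
have qq : `|q0 (p x) - q (p x)| <= e / 2.
  rewrite -(ler_pM2l a0); apply: ltW; apply: le_lt_trans Nq.
  apply: le_trans (ab _ (toCA _ cd)).1; rewrite ler_pM2l //.
  exact: (le_nrm cY (p x) cd).
rewrite -q0E in qq; rewrite (_ : f x - g x =
  (f x - U x - q (p x)) - (g x - U x - q (p x))); last by ring.
apply: le_trans (ler_normB _ _) _.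
rewrite (_ : e = e / 2 + 2 * (e / 4)); last by field.
apply: lerD => //; apply: le_trans (qE x) _.
by rewrite ler_pM2l.
Qed.

End main.

(** The zero function is a norm on the zero space, and its unit sphere is empty. The general
    construction takes a point of X, for instance in [sn_nrm]. *)
Lemma empty_LUR_lsc (R : realType) (T : topologicalType) :
  (T -> False) -> has_LUR_lsc_norm R [set: T].
Proof.
move=> T0; have T0' : [set: T] = set0 by apply/seteqP; split => // t; case: (T0 t).
exists (fun=> 0); split.
- split=> [//|//|f _ _ t|a f _|f g _ _]; first by case: (T0 t).
    by rewrite mulr0.
  by rewrite addr0.
- exists 1, 1; split => // f _.
  by rewrite /supnorm T0' image_set0 sup0 mulr0.
- by move=> x xs _ _ /eqP; rewrite eq_sym oner_eq0.
- by move=> f _ e e0; exists [::], 1; split => // g _ _; rewrite sub0r oppr_lt0.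
Qed.

Theorem theorem1p2 (R : realType) (X Y : topologicalType) (p : X -> Y) :
  compact_hausdorff X -> compact_hausdorff Y ->
  continuous p -> (forall y : Y, exists x : X, p x = y) ->
  fully_closed p ->
  has_LUR_lsc_norm R [set: Y] ->
  (forall y : Y, has_LUR_lsc_norm R (p @^-1` [set y])) ->
  has_LUR_lsc_norm R [set: X].
Proof.
move=> hX hY cp sp fp hN hfib.
have [[x0 _]|X0] := pselect ([set: X] !=set0).
  exact: (fully_closed_LUR hX hY cp sp x0 fp hN hfib).
by apply: empty_LUR_lsc => x; apply: X0; exists x.
Qed.
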